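(* Let $c_1=0$, let $\phi\in S_h^1(D)$ and let $\mathbf x_k\in\mathfrak S(\phi)$ be fixed. Let $V^{(k)}$ be the vector field on $\partial\Omega(\phi)\cap D$ that corresponds to a perturbation of the value of $\phi$ at the node $\mathbf x_k$. Then the discretized boundary shape derivative satisfies $$\begin{aligned}dg(\Omega(\phi))(V^{(k)})=\;&\Delta\lambda\sum_{l\in C_k}\mathbf p_l^\top\mathbf k_{0,l}\mathbf u_l\,d_ka_l+\Delta\alpha\sum_{l\in C_k}\mathbf p_l^\top d_k\mathbf m_l^I\,\mathbf u_l-\Delta f\sum_{l\in C_k}\mathbf p_l^\top d_k\mathbf f_l^I\\&+c_2\Delta\tilde\alpha\sum_{l\in C_k}(\mathbf u_l-\hat{\mathbf u}_l)^\top d_k\mathbf m_l^I(\mathbf u_l-\hat{\mathbf u}_l)\\&-2\Delta\lambda\sum_{l\in C_k}(\nabla u_h\cdot n)|_{\tau_l\cap\partial\Omega(\phi)}\,(\nabla p_h\cdot n)|_{\tau_l\cap\partial\Omega(\phi)}\,d_ka_l,\end{aligned}$$ where $\Delta\alpha=\alpha_1-\alpha_2$, $\Delta\lambda=\lambda_1-\lambda_2$, $\Delta f=f_1-f_2$, $\Delta\tilde\alpha=\tilde\alpha_1-\tilde\alpha_2$, $\mathbf u_l,\mathbf p_l,\hat{\mathbf u}_l\in\mathbb R^3$ are the nodal values of $u_h,p_h,\hat u_h$ at $\mathbf x_{l_1},\mathbf x_{l_2},\mathbf x_{l_3}$, $n$ is the unit normal to the interface in $\tau_l$ pointing out of $\Omega(\phi)$,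 $\mathbf k_{0,l}[i,j]=(J_l^{-\top}\nabla_\xi\psi_j)^\top(J_l^{-\top}\nabla_\xi\psi_i)$, $I\in\{A^\pm,B^\pm,C^\pm\}$ is the cut configuration of $\tau_l$, and $d_ka_l$, $d_k\mathbf m_l^I$, $d_k\mathbf f_l^I$ are the explicit quantities given in the context.
   Context: **Mesh.** $D\subset\mathbb R^2$ is a bounded polygonal domain with a conforming finite element mesh with nodes $\mathbf x_1,\dots,\mathbf x_M$ and (open) triangles $\tau_1,\dots,\tau_N$. $I_{\mathbf x_k}=\{l:\mathbf x_k\in\bar\tau_l\}$; $R_{\mathbf x_k}=\{i:\exists l\in I_{\mathbf x_k},\ \mathbf x_i\in\bar\tau_l\}$. $S_h^1(D)$ is the space of continuous functions that are affine on each triangle, with hat basis $\varphi_i(\mathbf x_j)=\delta_{ij}$. For $l\in I_{\mathbf x_k}$ the vertices of $\tau_l$ are $\mathbf x_{l_1},\mathbf x_{l_2},\mathbf x_{l_3}$ in counter-clockwise order with $l_1=k$, and $J_l=[\mathbf x_{l_2}-\mathbf x_{l_1},\ \mathbf x_{l_3}-\mathbf x_{l_1}]$. Reference shape functions: $\psi_1=1-\xi_1-\xi_2$, $\psi_2=\xi_1$, $\psi_3=\xi_2$. **Level sets.** For $\phi\in S_h^1(D)$, $\Omega(\phi)$ is the set where $\phi<0$ ($\phi>0$ on $D\setminus\overline{\Omega(\phi)}$ and $\phi=0$ on $\partial\Omega(\phi)\cap D$). $\mathfrak S(\phi)$ is the set of nodes $\mathbf x_k$ for which neither $\phi(\mathbf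 x_i)\le0$ for all $i\in R_{\mathbf x_k}$ nor $\phi(\mathbf x_i)\ge0$ for all $i\in R_{\mathbf x_k}$. $S_{k,\varepsilon}\phi=\phi+\varepsilon\varphi_k$; $C_k=\{l\in I_{\mathbf x_k}:\tau_l\cap\partial\Omega(S_{k,\varepsilon}\phi)\neq\emptyset\}$ for all small $\varepsilon>0$. With $\tilde\phi_{l_j}=(S_{k,\varepsilon}\phi)(\mathbf x_{l_j})$, $\varepsilon>0$ small, $l\in I_{\mathbf x_k}$ has configuration $A^+$, $B^+$, $C^+$, $A^-$, $B^-$, $C^-$ if the signs of $(\tilde\phi_{l_1},\tilde\phi_{l_2},\tilde\phi_{l_3})$ are respectively $(+,-,-)$, $(-,+,-)$, $(-,-,+)$, $(-,+,+)$, $(+,-,+)$, $(+,+,-)$ (strict). Standing assumption: every $l\in C_k$ has one of these six configurations (and only such $l$ lie in $C_k$). **The vector field $V^{(k)}$.** Put $\phi_{l_j}=\phi(\mathbf x_{l_j})$ and $\mathbf y(\mathbf p,\mathbf q,a,b)=\mathbf p-\frac{a}{b-a}(\mathbf q-\mathbf p)$. In each $\tau_l$, $l\in C_k$, the interface of $S_{k,\varepsilon}\phi$ is parametrized by $s\in[0,1]$ via $p^A[\varepsilon](s)=(1-s)\mathbf y(\mathbf x_{l_1},\mathbf x_{l_2},\phi_{l_1}+\varepsilon,\phi_{l_2})+s\,\mathbf y(\mathbf x_{l_1},\mathbf x_{l_3},\phi_{l_1}+\varepsilon,\phi_{l_3})$ for $A^\pm$, $p^B[\varepsilon](s)=(1-s)\mathbf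 y(\mathbf x_{l_2},\mathbf x_{l_1},\phi_{l_2},\phi_{l_1}+\varepsilon)+s\,\mathbf y(\mathbf x_{l_2},\mathbf x_{l_3},\phi_{l_2},\phi_{l_3})$ for $B^\pm$, $p^C[\varepsilon](s)=(1-s)\mathbf y(\mathbf x_{l_3},\mathbf x_{l_1},\phi_{l_3},\phi_{l_1}+\varepsilon)+s\,\mathbf y(\mathbf x_{l_3},\mathbf x_{l_2},\phi_{l_3},\phi_{l_2})$ for $C^\pm$. On $\tau_l\cap\partial\Omega(\phi)$, $V^{(k)}$ at the point $p[0](s)$ is $\frac{d}{d\varepsilon}p[\varepsilon](s)|_{\varepsilon=0}$; $V^{(k)}$ vanishes on the rest of the interface. **Problem data, discrete state and adjoint.** Constants $\lambda_1,\lambda_2>0$, $\alpha_1,\alpha_2,\tilde\alpha_1,\tilde\alpha_2\ge0$, $f_1,f_2\in\mathbb R$, $c_1,c_2$; $\lambda_\Omega=\lambda_1$ on $\Omega$, $\lambda_2$ on $D\setminus\Omega$, and similarly $\alpha_\Omega,\tilde\alpha_\Omega,f_\Omega$. $\partial D$ is split into disjoint $\Gamma_D,\Gamma_N$, and either $|\Gamma_D|>0$ or $\alpha_1,\alpha_2>0$. $\hat u_h\in S_h^1(D)$ is the finite element approximation of the desired state $\hat u$. With $\Omega=\Omega(\phi)$, $u_h\in S_h^1(D)$, $u_h=g_D$ on $\Gamma_D$, solves $\int_D\lambda_\Omega\nabla u_h\cdot\nabla v+\alpha_\Omega u_hv\,dx=\int_Df_\Omega v\,dx$, and $p_h\in S_h^1(D)$,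 $p_h=0$ on $\Gamma_D$, solves $\int_D\lambda_\Omega\nabla v\cdot\nabla p_h+\alpha_\Omega vp_h\,dx=-2c_2\int_D\tilde\alpha_\Omega(u_h-\hat u_h)v\,dx$, both for all $v\in S_h^1(D)$ with $v=0$ on $\Gamma_D$. **Discretized shape derivative.** $dg(\Omega(\phi))(V^{(k)})=\int_{\partial\Omega(\phi)}L_h\,(V^{(k)}\cdot n)\,dS_x=\sum_{l\in C_k}\int_{\tau_l\cap\partial\Omega(\phi)}L_h\,(V^{(k)}\cdot n)\,dS_x$, with $n$ the unit normal pointing out of $\Omega(\phi)$ and, evaluated elementwise, $$L_h=c_1+c_2\Delta\tilde\alpha(u_h-\hat u_h)^2+\Delta\alpha\,u_hp_h-\Delta f\,p_h+\Delta\lambda\,\nabla u_h\cdot\nabla p_h-2\Delta\lambda(\nabla u_h\cdot n)(\nabla p_h\cdot n).$$ (This is the continuous Hadamard formula for the functional $c_1|\Omega|+c_2\int_D\tilde\alpha_\Omega|u-\hat u|^2dx$ with $u,p,\hat u$ replaced by $u_h,p_h,\hat u_h$.) Terms with $\tau_l\cap\partial\Omega(\phi)=\emptyset$ (possible only if $\phi_{l_1}=0$, where $d_ka_l=0$) are read as zero in sums involving $n$. **Explicit quantities.** Write $a=\phi_{l_1}$, $b=\phi_{l_2}$, $c=\phi_{l_3}$; $\sigma=+1$ for $A^+,B^+,C^+$ and $\sigma=-1$ for $A^-,B^-,C^-$. $d_ka_l=\sigma|\det J_l|\frac{a[a(b+c)-2bc]}{2(a-b)^2(a-c)^2}$ for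 $A^\pm$; $d_ka_l=-\sigma\frac{|\det J_l|}{2}\frac{b^2}{(b-c)(b-a)^2}$ for $B^\pm$; $d_ka_l=-\sigma\frac{|\det J_l|}{2}\frac{c^2}{(c-b)(c-a)^2}$ for $C^\pm$. $d_k\mathbf m_l^I=|\det J_l|\,\bar m^I$ with $\bar m^I$ symmetric, and $d_k\mathbf f_l^I=|\det J_l|\,\bar f^I$, where: $A^\pm$: $\bar m_{11}=\sigma\frac{a^4(b^3+b^2c+bc^2+c^3)-4ab^3c^3+6a^2b^2c^2(b+c)-4a^3bc(b^2+bc+c^2)}{4(a-b)^4(a-c)^4}$, $\bar m_{12}=-\sigma\frac{a^2(3a^2b^2+2a^2bc+a^2c^2-8ab^2c-4abc^2+6b^2c^2)}{12(a-b)^4(a-c)^3}$, $\bar m_{13}=-\sigma\frac{a^2(a^2b^2+2a^2bc+3a^2c^2-4ab^2c-8abc^2+6b^2c^2)}{12(a-b)^3(a-c)^4}$, $\bar m_{22}=\sigma\frac{a^3(3ab+ac-4bc)}{12(a-b)^4(a-c)^2}$, $\bar m_{23}=\sigma\frac{a^3(ab+ac-2bc)}{12(a-b)^3(a-c)^3}$, $\bar m_{33}=\sigma\frac{a^3(ab+3ac-4bc)}{12(a-b)^2(a-c)^4}$; $\bar f_1=-\sigma\frac{a(a^2b^2+a^2bc+a^2c^2-3ab^2c-3abc^2+3b^2c^2)}{3(a-b)^3(a-c)^3}$, $\bar f_2=\sigma\frac{a^2(2ab+ac-3bc)}{6(a-b)^3(a-c)^2}$, $\bar f_3=\sigma\frac{a^2(ab+2ac-3bc)}{6(a-b)^2(a-c)^3}$.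 $B^\pm$: $\bar m_{11}=-\sigma\frac{b^4}{4(a-b)^4(b-c)}$, $\bar m_{12}=\sigma\frac{b^3(3ab-4ac+bc)}{12(a-b)^4(b-c)^2}$, $\bar m_{13}=\sigma\frac{b^4}{12(a-b)^3(b-c)^2}$, $\bar m_{22}=-\sigma\frac{b^2(3a^2b^2-8a^2bc+6a^2c^2+2ab^2c-4abc^2+b^2c^2)}{12(a-b)^4(b-c)^3}$, $\bar m_{23}=-\sigma\frac{b^3(ab-2ac+bc)}{12(a-b)^3(b-c)^3}$, $\bar m_{33}=-\sigma\frac{b^4}{12(a-b)^2(b-c)^3}$; $\bar f_1=\sigma\frac{b^3}{3(a-b)^3(b-c)}$, $\bar f_2=-\sigma\frac{b^2(2ab-3ac+bc)}{6(a-b)^3(b-c)^2}$, $\bar f_3=-\sigma\frac{b^3}{6(a-b)^2(b-c)^2}$. $C^\pm$: $\bar m_{11}=\sigma\frac{c^4}{4(a-c)^4(b-c)}$, $\bar m_{12}=\sigma\frac{c^4}{12(a-c)^3(b-c)^2}$, $\bar m_{13}=\sigma\frac{c^3(3ac-4ab+bc)}{12(a-c)^4(b-c)^2}$, $\bar m_{22}=\sigma\frac{c^4}{12(a-c)^2(b-c)^3}$, $\bar m_{23}=\sigma\frac{c^3(ac-2ab+bc)}{12(a-c)^3(b-c)^3}$, $\bar m_{33}=\sigma\frac{c^2(6a^2b^2-8a^2bc+3a^2c^2-4ab^2c+2abc^2+b^2c^2)}{12(a-c)^4(b-c)^3}$; $\bar f_1=-\sigma\frac{c^3}{3(a-c)^3(b-c)}$,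 $\bar f_2=-\sigma\frac{c^3}{6(a-c)^2(b-c)^2}$, $\bar f_3=-\sigma\frac{c^2(2ac-3ab+bc)}{6(a-c)^3(b-c)^2}$. *)

(* Defs.v *)
From HB Require Import structures.
From mathcomp Require Import all_boot all_order all_algebra.
From mathcomp Require Import all_classical all_reals all_analysis.

Set Implicit Arguments.
Unset Strict Implicit.
Unset Printing Implicit Defensive.

Import Order.TTheory GRing.Theory Num.Theory.
Import numFieldNormedType.Exports.

Local Open Scope classical_set_scope.
Local Open Scope ring_scope.

Section Plane.
Context {R : realType}.
Notation point := 'cV[R]_2.
Implicit Types (x P Q : point) (A S : set point).

Definition dot (u v : point) : R := (u^T *m v) ord0 ord0.

(* The library norm on matrices is the max norm. *)
Definition enorm (v : point) : R := Num.sqrt (dot v v).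

Definition grad (f : point -> R) x : point :=
  \col_(i < 2) 'D_(delta_mx i ord0) f x.

Definition boundary A : set point := closure A `\` A°.

Definition seg P Q (s : R) : point := (1 - s) *: P + s *: Q.

Definition open_segment P Q : set point :=
  [set x | exists2 s, 0 < s < 1 & x = seg P Q s].

Definition pt (z : R * R) : point :=
  \col_(i < 2) (if i == ord0 then z.1 else z.2).

Definition area_integral A (f : point -> R) : R :=
  Rintegral (@lebesgue_measure R \x @lebesgue_measure R)%E
    (pt @^-1` A) (f \o pt).

(* Integral with respect to arc length over a straight open segment S.
   The endpoints of S are unique up to a swap, which does not change the
   value. If S is empty no endpoints exist, the default (0, 0) is used, and
   the value is 0. *)
Definition segment_integral S (f : point -> R) : R :=
  let pq := xget ((0, 0) : point * point)
                 [set pq : point * point | S = open_segment pq.1 pq.2] in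
  enorm (pq.2 - pq.1) *
  Rintegral (@lebesgue_measure R) `]0, 1[ (fun s => f (seg pq.1 pq.2 s)).

Definition segment_length P Q A : \bar R :=
  ((enorm (Q - P))%:E *
   @lebesgue_measure R [set s : R | (0 <= s <= 1)%R /\ A (seg P Q s)])%E.

Definition jac (P1 P2 P3 : point) : 'M[R]_2 := row_mx (P2 - P1) (P3 - P1).

End Plane.

Definition v1 : 'I_3 := @Ordinal 3 0 isT.
Definition v2 : 'I_3 := @Ordinal 3 1 isT.
Definition v3 : 'I_3 := @Ordinal 3 2 isT.

Section Hull.
Context {R : realType} {M : nat}.
Variable x : 'I_M -> 'cV[R]_2.

Definition hull (S : {set 'I_M}) : set 'cV[R]_2 :=
  [set y | exists w : 'I_M -> R,
     [/\ forall i, 0 <= w i,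
         forall i, i \notin S -> w i = 0,
         \sum_i w i = 1 &
         y = \sum_i w i *: x i] ].

Definition open_hull (S : {set 'I_M}) : set 'cV[R]_2 :=
  [set y | exists w : 'I_M -> R,
     [/\ forall i, i \in S -> 0 < w i,
         forall i, i \notin S -> w i = 0,
         \sum_i w i = 1 &
         y = \sum_i w i *: x i] ].

End Hull.

(* A conforming triangulation. [vert l] lists the vertices of triangle l
   counter-clockwise, starting anywhere. The triangulated domain is the
   interior of the union of the closed triangles, hence automatically open,
   bounded and polygonal. *)
Record mesh (R : realType) := Mesh {
  nnodes : nat;
  ntri : nat;
  node : 'I_nnodes -> 'cV[R]_2;
  vert : 'I_ntri -> 'I_3 -> 'I_nnodes;
  verts := fun l => [set vert l i | i : 'I_3]%SET;
  node_inj : injective node;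
  node_used : forall i, exists l, i \in verts l;
  vert_ccw : forall l,
    0 < \det (jac (node (vert l v1)) (node (vert l v2)) (node (vert l v3)));
  tri_disjoint : forall l l', l != l' ->
    open_hull node (verts l) `&` open_hull node (verts l') = set0;
  mesh_conforming : forall l l',
    hull node (verts l) `&` hull node (verts l')
    = hull node (verts l :&: verts l')%SET;
  dom := (\bigcup_(l in [set: 'I_ntri]) hull node (verts l))°;
  dom_connected : connected dom
}.

Inductive cut := cutA | cutB | cutC.

(* (cutA, true) is the configuration A^+, (cutA, false) is A^-, etc. *)
Definition config := (cut * bool)%type.

Definition sigma (R : realType) (I : config) : R := if I.2 then 1 else -1.

Section LevelSets.
Context {R : realType}.
Variable T : mesh R.
Notation point := 'cV[R]_2.
Implicit Types (k i : 'I_(nnodes T)) (l : 'I_(ntri T)) (phi : point -> R).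

Definition tri l : set point := open_hull (@node R T) (verts l).
Definition tri_bar l : set point := hull (@node R T) (verts l).

(* S_h^1(D); only the values on the closure of D matter. *)
Definition Sh1 (f : point -> R) : Prop :=
  {within closure (dom T), continuous f} /\
  forall l, exists (g : point) (c : R),
    forall y, tri_bar l y -> f y = dot g y + c.

Definition is_hat_basis (hat : 'I_(nnodes T) -> point -> R) : Prop :=
  (forall i, Sh1 (hat i)) /\
  (forall i j, hat i (node j) = (i == j)%:R).

Definition I_ k l : Prop := tri_bar l (node k).
Definition R_ k i : Prop := exists2 l, I_ k l & tri_bar l (node i).

Definition Omega phi : set point := [set y | dom T y /\ phi y < 0].

Definition is_level_set_function phi : Prop :=
  (forall y, dom T y -> ~ closure (Omega phi) y -> 0 < phi y) /\
  (forall y, dom T y -> boundary (Omega phi) y -> phi y = 0).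

Definition interface phi l : set point := tri l `&` boundary (Omega phi).

Definition frakS phi k : Prop :=
  ~ (forall i, R_ k i -> phi (node i) <= 0) /\
  ~ (forall i, R_ k i -> 0 <= phi (node i)).

(* Vertices l_1, l_2, l_3 of triangle l, counter-clockwise with l_1 = k
   whenever k is a vertex of l; the addition is modulo 3. *)
Definition loc k l (j : 'I_3) : 'I_(nnodes T) :=
  vert l (odflt v1 [pick i | vert l i == k] + j).

Definition locx k l j : point := node (loc k l j).

Definition J k l : 'M[R]_2 := jac (locx k l v1) (locx k l v2) (locx k l v3).

Definition nodal k l (f : point -> R) : 'cV[R]_3 := \col_j f (locx k l j).

Section Perturbation.
Variables (hat : 'I_(nnodes T) -> point -> R) (phi : point -> R).

Definition Sop k (e : R) : point -> R := fun y => phi y + e * hat k y.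

Definition inC k l : Prop :=
  I_ k l /\ \forall e \near 0^'+, interface (Sop k e) l !=set0.

Definition C_ k : {set 'I_(ntri T)} := [set l | `[< inC k l >]]%SET.

(* In A^s the sign of the first vertex is s and that of the two others is -s;
   in B^s and C^s the distinguished vertex is the second, resp. the third. *)
Definition has_config k l (I : config) : Prop :=
  \forall e \near 0^'+,
    let sg j := Num.sg (Sop k e (locx k l j)) in
    let s := sigma R I in
    match I.1 with
    | cutA => [/\ sg v1 = s, sg v2 = - s & sg v3 = - s]
    | cutB => [/\ sg v1 = - s, sg v2 = s & sg v3 = - s]
    | cutC => [/\ sg v1 = - s, sg v2 = - s & sg v3 = s]
    end.

End Perturbation.

Definition ycut (p q : point) (a b : R) : point := p - (a / (b - a)) *: (q - p).

Definition param phi k l (I : config) (e s : R) : point :=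
  let x1 := locx k l v1 in
  let x2 := locx k l v2 in
  let x3 := locx k l v3 in
  let a := phi x1 in let b := phi x2 in let c := phi x3 in
  match I.1 with
  | cutA => seg (ycut x1 x2 (a + e) b) (ycut x1 x3 (a + e) c) s
  | cutB => seg (ycut x2 x1 b (a + e)) (ycut x2 x3 b c) s
  | cutC => seg (ycut x3 x1 c (a + e)) (ycut x3 x2 c b) s
  end.

Definition is_Vk hat phi k (cfg : 'I_(ntri T) -> config)
    (V : point -> point) : Prop :=
  (forall l s, l \in C_ hat phi k -> 0 <= s <= 1 ->
     interface phi l (param phi k l (cfg l) 0 s) ->
     is_derive (0 : R) (1 : R) (fun e : R => param phi k l (cfg l) e s)
       (V (param phi k l (cfg l) 0 s))) /\
  (forall y, dom T y -> boundary (Omega phi) y ->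
     (forall l, l \in C_ hat phi k -> ~ interface phi l y) -> V y = 0).

Definition is_outer_normal phi (n : point -> point) : Prop :=
  forall l y, interface phi l y ->
    [/\ enorm (n y) = 1,
        forall z, interface phi l z -> dot (n y) (z - y) = 0,
        \forall t \near 0^'+, Omega phi (y - t *: n y) &
        \forall t \near 0^'+, ~ Omega phi (y + t *: n y)].

(* Value on the interface in triangle l of a function that is constant there;
   0 if the interface does not meet the open triangle. *)
Definition on_interface phi l (g : point -> R) : R :=
  if `[< interface phi l !=set0 >] then g (xget 0 (interface phi l)) else 0.

End LevelSets.

Section Problem.
Context {R : realType}.
Variable T : mesh R.
Notation point := 'cV[R]_2.

(* One-dimensional measure of a subset of the boundary of D, as the sum over
   the boundary edges of the mesh. *)
Definition boundary_length (Gamma : set point) : \bar R :=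
  (\sum_(l < ntri T) \sum_(i < 3)
     let a := vert l i in
     let b := vert l (i + v2)%R in
     if `[< hull (@node R T) [set a; b]%SET `<=` boundary (dom T) >]
     then segment_length (node a) (node b) Gamma else 0)%E.

Definition piecewise (Om : set point) (a1 a2 : R) (y : point) : R :=
  if y \in Om then a1 else a2.

Definition is_discrete_state (Om GammaD : set point) (gD : point -> R)
    (lam1 lam2 al1 al2 f1 f2 : R) (u : point -> R) : Prop :=
  [/\ Sh1 T u,
      forall y, GammaD y -> u y = gD y &
      forall v, Sh1 T v -> (forall y, GammaD y -> v y = 0) ->
        area_integral (dom T) (fun y =>
          piecewise Om lam1 lam2 y * dot (grad u y) (grad v y)
          + piecewise Om al1 al2 y * u y * v y)
        = area_integral (dom T) (fun y => piecewise Om f1 f2 y * v y)].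

Definition is_discrete_adjoint (Om GammaD : set point)
    (lam1 lam2 al1 al2 alt1 alt2 c2 : R) (u uhat p : point -> R) : Prop :=
  [/\ Sh1 T p,
      forall y, GammaD y -> p y = 0 &
      forall v, Sh1 T v -> (forall y, GammaD y -> v y = 0) ->
        area_integral (dom T) (fun y =>
          piecewise Om lam1 lam2 y * dot (grad v y) (grad p y)
          + piecewise Om al1 al2 y * v y * p y)
        = - 2 * c2 * area_integral (dom T) (fun y =>
            piecewise Om alt1 alt2 y * (u y - uhat y) * v y)].

Definition Lh (c1 c2 dlam dal dalt df : R) (u p uhat : point -> R)
    (n : point -> point) (y : point) : R :=
  c1 + c2 * dalt * (u y - uhat y) ^+ 2 + dal * u y * p y - df * p y
  + dlam * dot (grad u y) (grad p y)
  - 2 * dlam * dot (grad u y) (n y) * dot (grad p y) (n y).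

(* Interface points on mesh edges either form a null set or, if a whole edge
   lies on the interface, carry V = 0; so the elementwise integral over the
   interface is the sum over the open triangles. *)
Definition dg (phi : point -> R) (L : point -> R) (n V : point -> point) : R :=
  \sum_(l < ntri T)
    segment_integral (interface phi l) (fun y => L y * dot (V y) (n y)).

End Problem.

Section ExplicitQuantities.
Context {R : realType}.

Definition psi (j : 'I_3) (xi : 'cV[R]_2) : R :=
  let xi1 := xi ord0 ord0 in
  let xi2 := xi ord_max ord0 in
  tnth [tuple 1 - xi1 - xi2; xi1; xi2] j.

(* The shape functions are affine: their gradient is the same everywhere. *)
Definition gradpsi (j : 'I_3) : 'cV[R]_2 := grad (psi j) 0.

Definition k0 (Jl : 'M[R]_2) : 'M[R]_3 :=
  \matrix_(i, j) dot ((invmx Jl)^T *m gradpsi j) ((invmx Jl)^T *m gradpsi i).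

Definition col3 (t1 t2 t3 : R) : 'cV[R]_3 :=
  \col_j tnth [tuple t1; t2; t3] j.

Definition sym3 (m11 m12 m13 m22 m23 m33 : R) : 'M[R]_3 :=
  \matrix_(i, j) tnth (tnth [tuple [tuple m11; m12; m13];
                                   [tuple m12; m22; m23];
                                   [tuple m13; m23; m33]] i) j.

(* On the reference triangle, the closed forms of the derivatives, with respect
   to the first nodal value a, of the area, mass matrix and load vector of the
   part where the affine function with nodal values a, b, c is negative. *)
Definition abar (I : config) (a b c : R) : R :=
  let s := sigma R I in
  match I.1 with
  | cutA => s * (a * (a * (b + c) - 2 * b * c))
              / (2 * (a - b) ^+ 2 * (a - c) ^+ 2)
  | cutB => - s * (1 / 2) * (b ^+ 2 / ((b - c) * (b - a) ^+ 2))
  | cutC => - s * (1 / 2) * (c ^+ 2 / ((c - b) * (c - a) ^+ 2))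
  end.

Definition mbar (I : config) (a b c : R) : 'M[R]_3 :=
  let s := sigma R I in
  match I.1 with
  | cutA => sym3
      (s * ((a ^+ 4 * (b ^+ 3 + b ^+ 2 * c + b * c ^+ 2 + c ^+ 3)
             - 4 * a * b ^+ 3 * c ^+ 3
             + 6 * a ^+ 2 * b ^+ 2 * c ^+ 2 * (b + c)
             - 4 * a ^+ 3 * b * c * (b ^+ 2 + b * c + c ^+ 2))
            / (4 * (a - b) ^+ 4 * (a - c) ^+ 4)))
      (- s * (a ^+ 2 * (3 * a ^+ 2 * b ^+ 2 + 2 * a ^+ 2 * b * c
                        + a ^+ 2 * c ^+ 2 - 8 * a * b ^+ 2 * c
                        - 4 * a * b * c ^+ 2 + 6 * b ^+ 2 * c ^+ 2)
              / (12 * (a - b) ^+ 4 * (a - c) ^+ 3)))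
      (- s * (a ^+ 2 * (a ^+ 2 * b ^+ 2 + 2 * a ^+ 2 * b * c
                        + 3 * a ^+ 2 * c ^+ 2 - 4 * a * b ^+ 2 * c
                        - 8 * a * b * c ^+ 2 + 6 * b ^+ 2 * c ^+ 2)
              / (12 * (a - b) ^+ 3 * (a - c) ^+ 4)))
      (s * (a ^+ 3 * (3 * a * b + a * c - 4 * b * c)
            / (12 * (a - b) ^+ 4 * (a - c) ^+ 2)))
      (s * (a ^+ 3 * (a * b + a * c - 2 * b * c)
            / (12 * (a - b) ^+ 3 * (a - c) ^+ 3)))
      (s * (a ^+ 3 * (a * b + 3 * a * c - 4 * b * c)
            / (12 * (a - b) ^+ 2 * (a - c) ^+ 4)))
  | cutB => sym3
      (- s * (b ^+ 4 / (4 * (a - b) ^+ 4 * (b - c))))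
      (s * (b ^+ 3 * (3 * a * b - 4 * a * c + b * c)
            / (12 * (a - b) ^+ 4 * (b - c) ^+ 2)))
      (s * (b ^+ 4 / (12 * (a - b) ^+ 3 * (b - c) ^+ 2)))
      (- s * (b ^+ 2 * (3 * a ^+ 2 * b ^+ 2 - 8 * a ^+ 2 * b * c
                        + 6 * a ^+ 2 * c ^+ 2 + 2 * a * b ^+ 2 * c
                        - 4 * a * b * c ^+ 2 + b ^+ 2 * c ^+ 2)
              / (12 * (a - b) ^+ 4 * (b - c) ^+ 3)))
      (- s * (b ^+ 3 * (a * b - 2 * a * c + b * c)
              / (12 * (a - b) ^+ 3 * (b - c) ^+ 3)))
      (- s * (b ^+ 4 / (12 * (a - b) ^+ 2 * (b - c) ^+ 3)))
  | cutC => sym3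
      (s * (c ^+ 4 / (4 * (a - c) ^+ 4 * (b - c))))
      (s * (c ^+ 4 / (12 * (a - c) ^+ 3 * (b - c) ^+ 2)))
      (s * (c ^+ 3 * (3 * a * c - 4 * a * b + b * c)
            / (12 * (a - c) ^+ 4 * (b - c) ^+ 2)))
      (s * (c ^+ 4 / (12 * (a - c) ^+ 2 * (b - c) ^+ 3)))
      (s * (c ^+ 3 * (a * c - 2 * a * b + b * c)
            / (12 * (a - c) ^+ 3 * (b - c) ^+ 3)))
      (s * (c ^+ 2 * (6 * a ^+ 2 * b ^+ 2 - 8 * a ^+ 2 * b * c
                      + 3 * a ^+ 2 * c ^+ 2 - 4 * a * b ^+ 2 * c
                      + 2 * a * b * c ^+ 2 + b ^+ 2 * c ^+ 2)
            / (12 * (a - c) ^+ 4 * (b - c) ^+ 3)))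
  end.

Definition fbar (I : config) (a b c : R) : 'cV[R]_3 :=
  let s := sigma R I in
  match I.1 with
  | cutA => col3
      (- s * (a * (a ^+ 2 * b ^+ 2 + a ^+ 2 * b * c + a ^+ 2 * c ^+ 2
                   - 3 * a * b ^+ 2 * c - 3 * a * b * c ^+ 2
                   + 3 * b ^+ 2 * c ^+ 2)
              / (3 * (a - b) ^+ 3 * (a - c) ^+ 3)))
      (s * (a ^+ 2 * (2 * a * b + a * c - 3 * b * c)
            / (6 * (a - b) ^+ 3 * (a - c) ^+ 2)))
      (s * (a ^+ 2 * (a * b + 2 * a * c - 3 * b * c)
            / (6 * (a - b) ^+ 2 * (a - c) ^+ 3)))
  | cutB => col3
      (s * (b ^+ 3 / (3 * (a - b) ^+ 3 * (b - c))))
      (- s * (b ^+ 2 * (2 * a * b - 3 * a * c + b * c)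
              / (6 * (a - b) ^+ 3 * (b - c) ^+ 2)))
      (- s * (b ^+ 3 / (6 * (a - b) ^+ 2 * (b - c) ^+ 2)))
  | cutC => col3
      (- s * (c ^+ 3 / (3 * (a - c) ^+ 3 * (b - c))))
      (- s * (c ^+ 3 / (6 * (a - c) ^+ 2 * (b - c) ^+ 2)))
      (- s * (c ^+ 2 * (2 * a * c - 3 * a * b + b * c)
              / (6 * (a - c) ^+ 3 * (b - c) ^+ 2)))
  end.

Variables (T : mesh R) (phi : 'cV[R]_2 -> R) (k : 'I_(nnodes T)).
Implicit Types (I : config) (l : 'I_(ntri T)).

Let a l := phi (locx k l v1).
Let b l := phi (locx k l v2).
Let c l := phi (locx k l v3).

Definition dka I l : R := `|\det (J k l)| * abar I (a l) (b l) (c l).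
Definition dkm I l : 'M[R]_3 := `|\det (J k l)| *: mbar I (a l) (b l) (c l).
Definition dkf I l : 'cV[R]_3 := `|\det (J k l)| *: fbar I (a l) (b l) (c l).

(* The matrix products below are 1 x 1. *)
Definition bil3 (p : 'cV[R]_3) (A : 'M[R]_3) (u : 'cV[R]_3) : R :=
  (p^T *m A *m u) ord0 ord0.
Definition dot3 (p f : 'cV[R]_3) : R := (p^T *m f) ord0 ord0.

End ExplicitQuantities.

(* Main.v *)
(* The identity holds triangle by triangle. Where phi is affine with gradient g,
   the normal is n = g / |g|, and differentiating the equation
   (phi + eps * hat_k)(p[eps](s)) = 0 at eps = 0 gives V . g = - hat_k, so
   V . n = - hat_k / |g|. With D = det J the interface has length
   |g| * D * kappa, where kappa depends only on the nodal values of phi; the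
   factor |g| cancels, and the integral over the triangle is
   - D * kappa * int_0^1 L_h hat_k ds along the cut. All functions involved
   are affine along the cut, so the integrals of products of two or three of
   them are bilinear or trilinear in their values at the two ends of the cut;
   evaluating them on the shape functions yields d_k f and d_k m. *)

(* The interface is a topological boundary met with an open triangle, while the arc-length integral
   only sees the endpoints of an open segment, picked by choice. So the cut is identified as the
   zero set of [phi] (a nonzero gradient makes every zero a boundary point), then as an open segment
   by barycentric coordinates, with endpoints unique up to order. Configurations describe
   [phi + eps * hat_k], so as [eps] tends to 0 the value [a] at [x_k] keeps only a weak sign. For B
   and C, [a = 0] is harmless: the cut then starts at [x_k]. For A it leaves the triangle without
   interface; there [kappa = 0] and both sides vanish. The three shapes are treated alike through
   the node separated from the other two. The gradient terms of [L_h] are constant on a triangle, so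
   they only multiply the integral of [hat_k], which gives [d_k a]; that [p^T k_0 u] is the product
   of the two gradients is seen by rebuilding a gradient from nodal values. *)
Require Import Defs.
From HB Require Import structures.
From mathcomp Require Import all_boot all_order all_algebra.
From mathcomp Require Import all_classical all_reals all_analysis.
From mathcomp Require Import measurable_realfun ring lra.
Import Order.TTheory GRing.Theory Num.Theory.
Import numFieldNormedType.Exports.
Local Open Scope classical_set_scope.
Local Open Scope ring_scope.

Set Implicit Arguments.
Unset Strict Implicit.

(** * Open segments in the plane and arc-length integrals of cubics *)

Section Plane.
Context {R : realType}.
Notation point := 'cV[R]_2.
Implicit Types (P Q g v w y : point) (c s t : R).

Lemma point_eqP v w :
  v ord0 ord0 = w ord0 ord0 -> v ord_max ord0 = w ord_max ord0 -> v = w.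
Proof.
move=> h0 h1; apply/matrixP => i j; rewrite (ord1 j).
by case: i => [[|[|//]] hi]; [rewrite (_ : Ordinal hi = ord0)|
  rewrite (_ : Ordinal hi = ord_max)] => //; apply/val_inj.
Qed.

Lemma dotE v w :
  dot v w = v ord0 ord0 * w ord0 ord0 + v ord_max ord0 * w ord_max ord0.
Proof.
by rewrite /dot mxE !big_ord_recl big_ord0 addr0 !mxE; congr (_ + _ * _);
  rewrite ?mxE; congr (_ _ _); apply/val_inj.
Qed.

Lemma dotDr g v w : dot g (v + w) = dot g v + dot g w.
Proof. by rewrite !dotE !mxE; ring. Qed.

Lemma dotNr g v : dot g (- v) = - dot g v.
Proof. by rewrite !dotE !mxE; ring. Qed.

Lemma dotZr g t v : dot g (t *: v) = t * dot g v.
Proof. by rewrite !dotE !mxE; ring. Qed.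

Lemma dotZl g t v : dot (t *: g) v = t * dot g v.
Proof. by rewrite !dotE !mxE; ring. Qed.

Lemma dotC v w : dot v w = dot w v.
Proof. by rewrite !dotE; ring. Qed.

Definition dot_linE := (dotDr, dotNr, dotZr).

Lemma dot_ge0 v : 0 <= dot v v.
Proof. by rewrite dotE -!expr2 addr_ge0 ?sqr_ge0. Qed.

Lemma dot_gt0 v : v != 0 -> 0 < dot v v.
Proof.
move=> v0; rewrite lt_neqAle dot_ge0 andbT eq_sym; apply: contra v0.
rewrite dotE -!expr2 paddr_eq0 ?sqr_ge0// !sqrf_eq0 => /andP[/eqP h0 /eqP h1].
by apply/eqP/point_eqP; rewrite mxE.
Qed.

Lemma enorm_gt0 v : v != 0 -> 0 < enorm v.
Proof. by move=> v0; rewrite sqrtr_gt0 dot_gt0. Qed.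

Lemma enorm_sqr v : enorm v ^+ 2 = dot v v.
Proof. by rewrite sqr_sqrtr// dot_ge0. Qed.

Lemma segE P Q s i : seg P Q s i ord0 = (1 - s) * P i ord0 + s * Q i ord0.
Proof. by rewrite !mxE. Qed.

Lemma seg_swap P Q s : seg Q P s = seg P Q (1 - s).
Proof. by apply: point_eqP; rewrite !segE; ring. Qed.

Lemma seg_affine P Q s1 s2 t : seg (seg P Q s1) (seg P Q s2) t =
  seg P Q ((1 - t) * s1 + t * s2).
Proof. by apply: point_eqP; rewrite !segE; ring. Qed.

Lemma segB P Q s t : seg P Q t - seg P Q s = (t - s) *: (Q - P).
Proof. by apply: point_eqP; rewrite !(segE, mxE); ring. Qed.

Lemma seg_inj P Q : P != Q -> injective (seg P Q).
Proof.
move=> PQ s t /eqP; rewrite eq_sym -subr_eq0 segB scaler_eq0.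
by rewrite !subr_eq0 [Q == P]eq_sym (negPf PQ) orbF => /eqP.
Qed.

Lemma dot_seg g P Q s : dot g (seg P Q s) = (1 - s) * dot g P + s * dot g Q.
Proof. by rewrite !dot_linE. Qed.

(** The map is increasing with image []A, B[]. If an end differed from 0 or 1, the point halfway
    between the two would be either a value in []0, 1[] that is missed or a value outside it. *)
Lemma unit_interval_ends (A B : R) : A < B ->
  (forall t, 0 < t < 1 -> 0 < (1 - t) * A + t * B < 1) ->
  (forall s, 0 < s < 1 -> exists2 t, 0 < t < 1 & (1 - t) * A + t * B = s) ->
  A = 0 /\ B = 1.
Proof.
move=> AB into onto.
(* This bounds [A + B] between 0 and 2, which keeps the halfway points and their parameters in range
   below. *)
have mid : 0 < (1 - 2^-1) * A + 2^-1 * B < 1 by apply: into; lra.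
have D0 : 0 < B - A by lra.
have D0' : B - A != 0 by rewrite gt_eqF.
split; apply/eqP; rewrite eq_le; apply/andP; split; rewrite leNgt; apply/negP => h.
- by have [|t t01] := onto (A / 2); [lra|nra].
- have /into : 0 < - A / (2 * (B - A)) < 1.
    by rewrite divr_gt0/= ?ltr_pdivrMr; lra.
  by rewrite (_ : _ + _ = A / 2); [lra|field].
- have /into : 0 < 1 - (B - 1) / (2 * (B - A)) < 1.
    by rewrite gtrBl subr_gt0 divr_gt0/= ?ltr_pdivrMr; lra.
  by rewrite (_ : _ + _ = (B + 1) / 2); [lra|field].
- by have [|t t01] := onto ((1 + B) / 2); [lra|nra].
Qed.

(** Makes the endpoints chosen by [segment_integral] computable. [P'] and [Q'] are not in the open
    segment, so they are extrapolated from its points at 1/3 and 2/3. *)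
Lemma open_segment_inj P Q P' Q' : P != Q ->
  open_segment P Q = open_segment P' Q' ->
  (P' = P /\ Q' = Q) \/ (P' = Q /\ Q' = P).
Proof.
move=> PQ E.
have inE t : 0 < t < 1 -> exists2 s, 0 < s < 1 & seg P' Q' t = seg P Q s.
  move=> t01; have : open_segment P' Q' (seg P' Q' t) by exists t.
  by rewrite -E => -[s s01 ->]; exists s.
have [x x01 Ex] : exists2 s, 0 < s < 1 & seg P' Q' (1 / 3) = seg P Q s.
  by apply: inE; lra.
have [y y01 Ey] : exists2 s, 0 < s < 1 & seg P' Q' (2 / 3) = seg P Q s.
  by apply: inE; lra.
pose A := 2 * x - y; pose B := 2 * y - x.
have EP : P' = seg P Q A.
  transitivity (seg (seg P' Q' (1/3)) (seg P' Q' (2/3)) (-1)).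
    by rewrite seg_affine; apply: point_eqP; rewrite !segE; field.
  by rewrite Ex Ey seg_affine /A; congr seg; ring.
have EQ : Q' = seg P Q B.
  transitivity (seg (seg P' Q' (1/3)) (seg P' Q' (2/3)) 2).
    by rewrite seg_affine; apply: point_eqP; rewrite !segE; field.
  by rewrite Ex Ey seg_affine /B; congr seg; ring.
have into t : 0 < t < 1 -> 0 < (1 - t) * A + t * B < 1.
  move=> t01; have [s s01] := inE t t01.
  by rewrite EP EQ seg_affine => /(seg_inj PQ) ->.
have onto s : 0 < s < 1 -> exists2 t, 0 < t < 1 & (1 - t) * A + t * B = s.
  move=> s01; have : open_segment P Q (seg P Q s) by exists s.
  rewrite E => -[t t01]; rewrite EP EQ seg_affine => /(seg_inj PQ) ->.
  by exists t.
have [AB | BA | AB] := ltgtP A B.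
- left; have [A0 B1] := unit_interval_ends AB into onto.
  by rewrite EP EQ A0 B1; split; apply: point_eqP; rewrite !segE; ring.
- right; have [||B0 A1] := unit_interval_ends BA.
  + by move=> t t01; rewrite addrC -[t in t * A](subKr 1); apply: into; lra.
  + move=> s /onto[t t01 ts]; exists (1 - t); first by lra.
    by rewrite -ts subKr addrC.
  by rewrite EP EQ B0 A1; split; apply: point_eqP; rewrite !segE; ring.
(* If [A = B] the map is constant and cannot take both values 1/3 and 1/2. *)
- exfalso; have [|t1 _ E1] := onto (1 / 3); first by lra.
  by have [|t2 _ E2] := onto (1 / 2); [lra|move: E1 E2; rewrite AB; lra].
Qed.

Lemma Rintegral_deriv_poly (p : {poly R}) :
  Rintegral (@lebesgue_measure R) `]0, 1[ (horner p^`()) = p.[1] - p.[0].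
Proof.
(* Adding the two endpoints, a null set, gives the closed interval on which the fundamental theorem
   is stated. *)
rewrite /Rintegral -(@integral_itv_bndoo _ _ _ _ true false); last first.
  apply/measurable_EFinP; apply: measurable_funTS.
  by apply: continuous_measurable_fun; exact: continuous_horner.
rewrite (@continuous_FTC2 _ _ (horner p))//=.
- by apply: continuous_subspaceT => x; exact: continuous_horner.
- split => [x _||].
  + exact: derivable_horner.
  + exact/cvg_at_right_filter/continuous_horner.
  + exact/cvg_at_left_filter/continuous_horner.
- by move=> x _; rewrite derivE.
Qed.

(** Degree three is what occurs: along the cut [L_h] is quadratic and [V . n] is affine. *)
Lemma Rintegral_cubic (f : R -> R) c0 c1 c2 c3 :
  (forall s, 0 < s < 1 -> f s = c0 + c1 * s + c2 * s ^+ 2 + c3 * s ^+ 3) ->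
  Rintegral (@lebesgue_measure R) `]0, 1[ f = c0 + c1 / 2 + c2 / 3 + c3 / 4.
Proof.
move=> fE; pose p : {poly R} := c0 *: 'X + (c1 / 2) *: 'X^2 + (c2 / 3) *: 'X^3
  + (c3 / 4) *: 'X^4.
transitivity (Rintegral (@lebesgue_measure R) `]0, 1[ (horner p^`())).
  have fp s : s \in `]0, 1[%classic -> f s = p^`().[s].
    rewrite inE/= in_itv/= => /fE ->.
    by rewrite /p !derivD !derivZ derivX !derivXn !hornerE/=; field.
  by apply: eq_Rintegral => s; exact: fp.
by rewrite Rintegral_deriv_poly /p !hornerE /=; field.
Qed.

Lemma segment_integral_cubic P Q (F : point -> R) c0 c1 c2 c3 : P != Q ->
  (forall s, 0 < s < 1 ->
     F (seg P Q s) = c0 + c1 * s + c2 * s ^+ 2 + c3 * s ^+ 3) ->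
  segment_integral (open_segment P Q) F =
  enorm (Q - P) * (c0 + c1 / 2 + c2 / 3 + c3 / 4).
Proof.
move=> PQ FE; rewrite /segment_integral.
case: xgetP => [[P' Q'] _ /= /(open_segment_inj PQ) E|none]; last first.
  by case: (none (P, Q)).
case: E => -[-> ->]; first by rewrite (Rintegral_cubic FE).
have enormC : enorm (P - Q) = enorm (Q - P).
  by rewrite /enorm; congr Num.sqrt; rewrite !dotE !mxE; ring.
rewrite enormC; congr (_ * _).
(* The chosen endpoints are in reverse order; these are the coefficients of the cubic taken at
   [1 - s]. *)
rewrite (@Rintegral_cubic _ (c0 + c1 + c2 + c3) (- c1 - 2 * c2 - 3 * c3)
  (c2 + 3 * c3) (- c3)); first by field.
by move=> s s01; rewrite seg_swap FE; [ring|lra].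
Qed.

(** [S] may be any set, since outside [C_] the shape of the interface is unknown: if it is no open
    segment, the default endpoints coincide and the length factor is 0. *)
Lemma segment_integral0 (S : set point) (F : point -> R) :
  (forall y, S y -> F y = 0) -> segment_integral S F = 0.
Proof.
move=> F0; rewrite /segment_integral.
case: xgetP => [[P Q] _ /= SE|_] /=; last first.
  by rewrite subrr /enorm dotE !mxE !mul0r addr0 sqrtr0 mul0r.
rewrite (@Rintegral_cubic _ 0 0 0 0); first by rewrite !mul0r !addr0 mulr0.
by move=> s s01; rewrite !mul0r !addr0; apply: F0; rewrite SE; exists s.
Qed.

End Plane.

(** * The closed forms as integrals along the cut *)

Section ClosedForms.
Context {R : realType}.
Implicit Types (I : config) (a b c s : R) (x y z : R * R).

(* A pair stands for the affine function on [0, 1] with these end values, and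
   int1, int2, int3 for the integral of a product of such functions. *)
Definition int1 x : R := (x.1 + x.2) / 2.
Definition int2 x y : R :=
  (2 * (x.1 * y.1 + x.2 * y.2) + x.1 * y.2 + x.2 * y.1) / 6.
Definition int3 x y z : R :=
  (3 * (x.1 * y.1 * z.1 + x.2 * y.2 * z.2)
   + (x.1 * y.1 * z.2 + x.1 * y.2 * z.1 + x.2 * y.1 * z.1)
   + (x.2 * y.2 * z.1 + x.2 * y.1 * z.2 + x.1 * y.2 * z.2)) / 12.

(* The value at the node cut off from the other two, then the values there. *)
Definition pivot I a b c : R * (R * R) :=
  match I.1 with
  | cutA => (a, (b, c))
  | cutB => (b, (a, c))
  | cutC => (c, (a, b))
  end.

(** Under [compatible], the factor [sigma] turns the quotient into its absolute value while keeping
    it rational, so that [field] applies. *)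
Definition kappa I a b c : R :=
  let: (q, (r1, r2)) := pivot I a b c in sigma R I * q / ((q - r1) * (q - r2)).

(* The weights of the three nodes at the two ends of the cut, where the affine
   function with nodal values a, b, c vanishes. *)
Definition bary I a b c : 'I_3 -> R * R :=
  let: (q, (r1, r2)) := pivot I a b c in
  let al := q / (q - r1) in let be := q / (q - r2) in
  let al' := - r1 / (q - r1) in let be' := - r2 / (q - r2) in
  match I.1 with
  | cutA => tnth [tuple (al', be'); (al, 0); (0, be)]
  | cutB => tnth [tuple (al, 0); (al', be'); (0, be)]
  | cutC => tnth [tuple (al, 0); (0, be); (al', be')]
  end.

(** Kept apart from the sign pattern: nonzero denominators persist under small changes of [a] of
    either sign, as the two-sided derivative at [eps = 0] requires. *)
Definition cuttable I a b c : bool :=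
  let: (q, (r1, r2)) := pivot I a b c in (q - r1 != 0) && (q - r2 != 0).

Let subr0C (x y : R) : x - y != 0 -> y - x != 0.
Proof. by rewrite -opprB oppr_eq0. Qed.

(** Here and in the next two lemmas no sign matters, so [sigma] is generalised to an arbitrary
    factor and each configuration is one rational identity. *)
Lemma abarE I a b c : cuttable I a b c ->
  abar I a b c = - kappa I a b c * int1 (bary I a b c v1).
Proof.
rewrite /cuttable /abar /kappa /bary /pivot /int1.
case: I => -[] s /= /andP[h1 h2]; have [h1' h2'] := (subr0C h1, subr0C h2);
move: (sigma _ _) => sg; field;
  by rewrite ?h1 ?h2 ?h1' ?h2'.
Qed.

Lemma fbarE I a b c i : cuttable I a b c ->
  fbar I a b c i ord0 = - kappa I a b c * int2 (bary I a b c v1) (bary I a b c i).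
Proof.
rewrite /cuttable /fbar /col3 /kappa /bary /pivot /int2.
case: I => -[] s /= /andP[h1 h2]; have [h1' h2'] := (subr0C h1, subr0C h2);
rewrite !mxE; move: (sigma _ _) => sg;
case: i => [[|[|[|//]]] hi]; rewrite !(tnth_nth 0) /=; field;
  by rewrite ?h1 ?h2 ?h1' ?h2'.
Qed.

Lemma mbarE I a b c i j : cuttable I a b c ->
  mbar I a b c i j =
  - kappa I a b c * int3 (bary I a b c v1) (bary I a b c i) (bary I a b c j).
Proof.
rewrite /cuttable /mbar /sym3 /kappa /bary /pivot /int3.
case: I => -[] s /= /andP[h1 h2]; have [h1' h2'] := (subr0C h1, subr0C h2);
rewrite !mxE; move: (sigma _ _) => sg;
case: i => [[|[|[|//]]] hi]; case: j => [[|[|[|//]]] hj];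
rewrite !(tnth_nth [tuple 0; 0; 0]) !(tnth_nth 0) /=; field;
  by rewrite ?h1 ?h2 ?h1' ?h2'.
Qed.

End ClosedForms.

(** * A line cutting a triangle: zero set, length and normal *)

Section Cut.
Context {R : realType}.
Notation point := 'cV[R]_2.
Implicit Types (X P Q g n v w y : point) (a b c s t q r : R) (I : config).

Lemma det_mx2 (A : 'M[R]_2) : \det A =
  A ord0 ord0 * A ord_max ord_max - A ord0 ord_max * A ord_max ord0.
Proof.
have l1 (i : 'I_1) : lift ord0 i = ord_max :> 'I_2.
  by apply: val_inj; rewrite (ord1 i).
have l0 (i : 'I_1) : lift ord_max i = ord0 :> 'I_2.
  by apply: val_inj; rewrite (ord1 i).
rewrite (expand_det_row _ ord0) !big_ord_recl big_ord0 /cofactor !det_mx11.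
by rewrite !mxE !l1 !l0 /= expr0 expr1; ring.
Qed.

Lemma jac_col (X1 X2 X3 : point) i :
  (jac X1 X2 X3 i ord0 = (X2 - X1) i ord0) *
  (jac X1 X2 X3 i ord_max = (X3 - X1) i ord0).
Proof.
split; [rewrite -(row_mxEl (X2 - X1) (X3 - X1))
       |rewrite -(row_mxEr (X2 - X1) (X3 - X1))];
  by congr (jac _ _ _ _ _); apply: val_inj.
Qed.

Lemma det_jac (X1 X2 X3 : point) : \det (jac X1 X2 X3) =
  (X2 - X1) ord0 ord0 * (X3 - X1) ord_max ord0
  - (X2 - X1) ord_max ord0 * (X3 - X1) ord0 ord0.
Proof.
by rewrite det_mx2 !jac_col; ring.
Qed.

Lemma enormZ t v : enorm (t *: v) = `|t| * enorm v.
Proof.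
rewrite /enorm dotZl dotZr mulrA -expr2 sqrtrM ?sqr_ge0//.
by rewrite sqrtr_sqr.
Qed.

Definition open_triangle (X1 X2 X3 : point) : set point :=
  [set y | exists t1 t2 t3 : R, [/\ 0 < t1, 0 < t2, 0 < t3, t1 + t2 + t3 = 1 &
     y = t1 *: X1 + t2 *: X2 + t3 *: X3]].

Lemma open_triangle_swap (X1 X2 X3 : point) :
  open_triangle X1 X2 X3 = open_triangle X2 X1 X3.
Proof.
rewrite eqEsubset; split => y [t1 [t2 [t3 [h1 h2 h3 h ->]]]];
  exists t2, t1, t3; split => //.
- by rewrite -h; ring.
- by rewrite (addrC (t1 *: _)).
- by rewrite -h; ring.
- by rewrite (addrC (t1 *: _)).
Qed.

Lemma open_triangle_rot (X1 X2 X3 : point) :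
  open_triangle X1 X2 X3 = open_triangle X3 X1 X2.
Proof.
rewrite eqEsubset; split => y [t1 [t2 [t3 [h1 h2 h3 h ->]]]];
  [exists t3, t1, t2|exists t2, t3, t1]; split => //.
- by rewrite -h; ring.
- by rewrite addrC addrA.
- by rewrite -h; ring.
- by rewrite -addrA addrC.
Qed.

(** A point of the cut has weights [(1 - s) * (1 - al) + s * (1 - be)], [(1 - s) * al] and [s * be].
    For [r1 = 0] the cut starts at [X2], as [al = 1]; then [be < 1] keeps the first weight
    positive. *)
Lemma zero_set_pivot (X1 X2 X3 g : point) (c sg q r1 r2 : R) :
  dot g X1 + c = q -> dot g X2 + c = r1 -> dot g X3 + c = r2 ->
  0 < sg * q -> sg * r1 <= 0 -> sg * r2 < 0 ->
  [set y | open_triangle X1 X2 X3 y /\ dot g y + c = 0] =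
  open_segment (ycut X1 X2 q r1) (ycut X1 X3 q r2).
Proof.
move=> h1 h2 h3 q0 r10 r20.
have sg0 : sg != 0 by apply/eqP => sg0; move: q0; rewrite sg0 mul0r ltxx.
have q_neq0 : q != 0 by apply/eqP => Eq; move: q0; rewrite Eq mulr0 ltxx.
have d1 : 0 < sg * (q - r1) by rewrite mulrBr; lra.
have d2 : 0 < sg * (q - r2) by rewrite mulrBr; lra.
have d1_neq0 : q - r1 != 0.
  by apply/eqP => Eq; move: d1; rewrite Eq mulr0 ltxx.
have d2_neq0 : q - r2 != 0.
  by apply/eqP => Eq; move: d2; rewrite Eq mulr0 ltxx.
have d1_neq0' : r1 - q != 0 by rewrite -opprB oppr_eq0.
have d2_neq0' : r2 - q != 0 by rewrite -opprB oppr_eq0.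
have alE r : q - r != 0 -> q / (q - r) = (sg * q) / (sg * (q - r)).
  by move=> d0; field; rewrite sg0 d0.
have al_gt0 : 0 < q / (q - r1) by rewrite alE// divr_gt0.
have be_gt0 : 0 < q / (q - r2) by rewrite alE// divr_gt0.
have al_le1 : q / (q - r1) <= 1.
  by rewrite alE// ler_pdivrMr// mul1r mulrBr; lra.
have be_lt1 : q / (q - r2) < 1.
  by rewrite alE// ltr_pdivrMr// mul1r mulrBr; lra.
set al := q / (q - r1) in al_gt0 al_le1.
set be := q / (q - r2) in be_gt0 be_lt1.
have segP s : seg (ycut X1 X2 q r1) (ycut X1 X3 q r2) s =
  ((1 - s) * (1 - al) + s * (1 - be)) *: X1 + ((1 - s) * al) *: X2
  + (s * be) *: X3.
  by rewrite /ycut; apply: point_eqP; rewrite !(segE, mxE) /al /be; field;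
    rewrite ?d1_neq0 ?d2_neq0 ?d1_neq0' ?d2_neq0'.
rewrite eqEsubset; split => y.
- move=> [[t1 [t2 [t3 [t10 t20 t30 tsum ->]]]]]; rewrite !dot_linE => zero.
  have z : t1 * q + t2 * r1 + t3 * r2 = 0.
    rewrite -h1 -h2 -h3 -[RHS]zero -[in RHS](mul1r c) -tsum; ring.
  have t12 : t2 / al + t3 / be = 1.
    rewrite /al /be !invf_div.
    have -> : t2 * ((q - r1) / q) + t3 * ((q - r2) / q) =
      ((t1 + t2 + t3) * q - (t1 * q + t2 * r1 + t3 * r2)) / q by field.
    by rewrite tsum z subr0 mul1r divff.
  have al0 : al != 0 by rewrite gt_eqF.
  have be0 : be != 0 by rewrite gt_eqF.
  (* The weight of [X3] forces this parameter. *)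
  exists (t3 / be).
    by have := divr_gt0 t20 al_gt0; have := divr_gt0 t30 be_gt0; lra.
  have E2 : t2 / al * al = t2 by rewrite divfK.
  have E3 : t3 / be * be = t3 by rewrite divfK.
  rewrite segP (_ : 1 - t3 / be = t2 / al); last by lra.
  rewrite E2 E3; congr (_ *: _ + _ + _).
  by rewrite !mulrBr !mulr1 E2 E3; lra.
- move=> [s s01 ->]; split.
    rewrite segP; exists ((1 - s) * (1 - al) + s * (1 - be)), ((1 - s) * al),
      (s * be).
    by split => //; [nra|rewrite mulr_gt0//; lra|rewrite mulr_gt0//; lra|ring].
  rewrite segP !dot_linE.
  transitivity (((1 - s) * (1 - al) + s * (1 - be)) * q + (1 - s) * al * r1
    + s * be * r2); first by rewrite -h1 -h2 -h3; ring.
  by rewrite /al /be; field; rewrite d1_neq0 d2_neq0.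
Qed.

(** The cut is orthogonal to [g], hence a multiple of [g] turned by a right angle. The multiple
    comes from the planar identity [(g . v) w - (g . w) v = det (w, v) rot] for the edge vectors
    [w = X2 - X1] and [v = X3 - X1]. *)
Lemma ycut_dist_pivot (X1 X2 X3 g : point) (c q r1 r2 : R) :
  dot g X1 + c = q -> dot g X2 + c = r1 -> dot g X3 + c = r2 ->
  q - r1 != 0 -> q - r2 != 0 ->
  enorm (ycut X1 X3 q r2 - ycut X1 X2 q r1) =
  enorm g * `|\det (jac X1 X2 X3)| * `|q / ((q - r1) * (q - r2))|.
Proof.
move=> h1 h2 h3 d1 d2.
have d1' : r1 - q != 0 by rewrite -opprB oppr_eq0.
have d2' : r2 - q != 0 by rewrite -opprB oppr_eq0.
pose rot : point :=
  \col_i (if i == ord0 then g ord_max ord0 else - g ord0 ord0).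
have rotE : enorm rot = enorm g.
  by rewrite /enorm !dotE !mxE/=; congr Num.sqrt; ring.
have -> : ycut X1 X3 q r2 - ycut X1 X2 q r1 =
    (q / ((q - r1) * (q - r2)) * \det (jac X1 X2 X3)) *: rot.
  have -> : ycut X1 X3 q r2 - ycut X1 X2 q r1 =
    (q / ((q - r1) * (q - r2))) *:
       ((q - r1) *: (X3 - X1) - (q - r2) *: (X2 - X1)).
    by apply: point_eqP; rewrite !mxE; field; rewrite d1 d2 d1' d2'.
  have E1 : q - r1 = - dot g (X2 - X1) by rewrite -h1 -h2 !dot_linE; ring.
  have E2 : q - r2 = - dot g (X3 - X1) by rewrite -h1 -h3 !dot_linE; ring.
  rewrite -[RHS]scalerA; congr (_ *: _).
  rewrite E1 E2 det_jac !dotE.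
  by apply: point_eqP; rewrite !mxE /=; ring.
by rewrite enormZ rotE normrM; ring.
Qed.

(** In the plane, two vectors orthogonal to [v] have zero cross product, so Lagrange's identity
    gives [|g| = |g . n|]; the sign of [g . n] fixes the orientation. *)
Lemma parallel_unit_normal g n v : v != 0 -> dot g v = 0 -> dot n v = 0 ->
  enorm n = 1 -> 0 < dot g n -> n = (enorm g)^-1 *: g.
Proof.
move=> v0 gv nv n1 gn.
have g0 : g != 0.
  by apply/eqP => g0; move: gn; rewrite g0 dotE !mxE !mul0r addr0 ltxx.
have par : g ord0 ord0 * n ord_max ord0 = g ord_max ord0 * n ord0 ord0.
  apply/eqP; rewrite -subr_eq0; apply: contraNT v0 => par.
  apply/eqP/point_eqP; rewrite mxE; apply: (mulfI par); rewrite mulr0.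
  - transitivity (dot g v * n ord_max ord0 - dot n v * g ord_max ord0).
      by rewrite !dotE; ring.
    by rewrite gv nv !mul0r subrr.
  - transitivity (dot n v * g ord0 ord0 - dot g v * n ord0 ord0).
      by rewrite !dotE; ring.
    by rewrite gv nv !mul0r subrr.
have nn : dot n n = 1 by rewrite -enorm_sqr n1 expr1n.
have gnE : dot g n = enorm g.
  have gg : dot g g = dot g n ^+ 2.
    rewrite -[LHS]mulr1 -nn; move: par; rewrite !dotE.
    by move=> par; apply/eqP; rewrite -subr_eq0; apply/eqP;
      transitivity ((g ord0 ord0 * n ord_max ord0
                     - g ord_max ord0 * n ord0 ord0) ^+ 2);
      [ring|rewrite par subrr expr0n].
  by rewrite /enorm gg sqrtr_sqr gtr0_norm.
rewrite -gnE; apply/(scalerI (lt0r_neq0 gn)).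
rewrite scalerA divff ?gt_eqF// scale1r.
have n2 : n ord0 ord0 ^+ 2 + n ord_max ord0 ^+ 2 = 1 by rewrite -nn dotE.
apply: point_eqP; rewrite !mxE dotE.
- transitivity (g ord0 ord0 * (n ord0 ord0 ^+ 2) + (g ord_max ord0 * n ord0 ord0)
    * n ord_max ord0); first by ring.
  by rewrite -par -[RHS]mulr1 -n2; ring.
- transitivity ((g ord0 ord0 * n ord_max ord0) * n ord0 ord0
    + g ord_max ord0 * n ord_max ord0 ^+ 2); first by ring.
  by rewrite par -[RHS]mulr1 -n2; ring.
Qed.

End Cut.

(** * The three configurations in one notation *)

Section Ends.
Context {R : realType}.
Notation point := 'cV[R]_2.
Implicit Types (g n v w y : point) (a b c e s : R) (I : config) (X : 'I_3 -> point).

Definition ends X I a b c : point * point :=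
  match I.1 with
  | cutA => (ycut (X v1) (X v2) a b, ycut (X v1) (X v3) a c)
  | cutB => (ycut (X v2) (X v1) b a, ycut (X v2) (X v3) b c)
  | cutC => (ycut (X v3) (X v1) c a, ycut (X v3) (X v2) c b)
  end.

(** The sign pattern left as [eps] tends to 0: [b] and [c] do not move and stay strict, [a] may
    vanish. In A this would shrink the cut to a point, so it is excluded here and treated
    separately. *)
Definition compatible I a b c : Prop :=
  let s := sigma R I in
  match I.1 with
  | cutA => [/\ 0 < s * a, s * b < 0 & s * c < 0]
  | cutB => [/\ s * a <= 0, 0 < s * b & s * c < 0]
  | cutC => [/\ s * a <= 0, s * b < 0 & 0 < s * c]
  end.

Lemma compatible_cuttable I a b c :
  compatible I a b c -> cuttable I a b c.
Proof.
rewrite /compatible /cuttable /pivot; case: I => -[] t /=;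
  move: (sigma _ _) => sg [h1 h2 h3]; apply/andP; split;
  apply/eqP => h; move: (congr1 ( *%R sg) h); rewrite mulrBr mulr0; lra.
Qed.

Lemma zero_set_ends X I g (c0 : R) a b c :
  dot g (X v1) + c0 = a -> dot g (X v2) + c0 = b -> dot g (X v3) + c0 = c ->
  compatible I a b c ->
  [set y | open_triangle (X v1) (X v2) (X v3) y /\ dot g y + c0 = 0] =
  open_segment (ends X I a b c).1 (ends X I a b c).2.
Proof.
move=> h1 h2 h3; rewrite /compatible /ends; case: I => -[] t /= [i1 i2 i3].
- exact: (zero_set_pivot h1 h2 h3 i1 (ltW i2) i3).
(* The pivot is moved to the first place and [x_k] to the second, the one where the value may be
   zero. *)
- by rewrite open_triangle_swap; exact: (zero_set_pivot h2 h1 h3 i2 i1 i3).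
- by rewrite open_triangle_rot; exact: (zero_set_pivot h3 h1 h2 i3 i1 i2).
Qed.

(* sigma is the sign of the pivot value. *)
Lemma kappa_gt0 I a b c : compatible I a b c -> 0 < kappa I a b c.
Proof.
rewrite /compatible /kappa /pivot; case: I => -[] t /=;
  rewrite /sigma; case: t => /= -[h1 h2 h3].
all: rewrite divr_gt0//; try lra; nra.
Qed.

Lemma ends_dist X I g (c0 : R) a b c :
  dot g (X v1) + c0 = a -> dot g (X v2) + c0 = b -> dot g (X v3) + c0 = c ->
  compatible I a b c ->
  enorm ((ends X I a b c).2 - (ends X I a b c).1) =
  enorm g * (`|\det (jac (X v1) (X v2) (X v3))| * kappa I a b c).
Proof.
move=> h1 h2 h3 comp; have := kappa_gt0 comp.
move/compatible_cuttable: comp.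
have normE q r1 r2 : `|q / ((q - r1) * (q - r2))| =
    `|sigma R I * q / ((q - r1) * (q - r2))|.
  have s1 : `|sigma R I| = 1 by rewrite /sigma; case: I.2; rewrite ?normrN normr1.
  by rewrite -[sigma R I * q / _]mulrA [RHS]normrM s1 mul1r.
rewrite /cuttable /kappa /pivot /ends; case: I normE => -[] t /= normE.
- move=> /andP[d1 d2] /gtr0_norm <-.
  by rewrite (ycut_dist_pivot h1 h2 h3 d1 d2) normE mulrA.
- move=> /andP[d1 d2] /gtr0_norm <-.
  rewrite (ycut_dist_pivot h2 h1 h3 d1 d2) normE mulrA; congr (_ * _ * _).
  by rewrite -[LHS]normrN; congr `|_|; rewrite !det_jac !mxE; ring.
- move=> /andP[d1 d2] /gtr0_norm <-.
  rewrite (ycut_dist_pivot h3 h1 h2 d1 d2) normE mulrA; congr (_ * _ * _).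
  by congr `|_|; rewrite !det_jac !mxE; ring.
Qed.

(** The affine function is unrelated to the values [a], [b], [c] that place the cut, so this serves
    [phi], [u], [p] and the misfit alike. *)
Lemma ends_affine X I g (c0 : R) a b c : cuttable I a b c ->
  dot g (ends X I a b c).1 + c0 =
    \sum_j (dot g (X j) + c0) * (bary I a b c j).1 /\
  dot g (ends X I a b c).2 + c0 =
    \sum_j (dot g (X j) + c0) * (bary I a b c j).2.
Proof.
have o1 : ord0 = v1 by apply: val_inj.
have o2 : lift ord0 ord0 = v2 by apply: val_inj.
have o3 : lift ord0 (lift ord0 ord0) = v3 by apply: val_inj.
rewrite /cuttable /ends /bary /pivot !big_ord_recl !big_ord0.
rewrite o2 o3 o1.
case: I => -[] t /= /andP[h1 h2]; rewrite /ycut !dot_linE;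
  have h1' := h1; have h2' := h2; rewrite -opprB oppr_eq0 in h1';
  rewrite -opprB oppr_eq0 in h2';
  by split; field; rewrite ?h1 ?h2 ?h1' ?h2'.
Qed.

Lemma bary_zero I a b c : cuttable I a b c ->
  a * (bary I a b c v1).1 + b * (bary I a b c v2).1 + c * (bary I a b c v3).1 = 0 /\
  a * (bary I a b c v1).2 + b * (bary I a b c v2).2 + c * (bary I a b c v3).2 = 0.
Proof.
rewrite /cuttable /bary /pivot.
case: I => -[] t /= /andP[h1 h2];
  by split; field; rewrite ?h1 ?h2.
Qed.

End Ends.

(** * Velocity of the moving cut, and gradients of locally affine functions *)

Section Velocity.
Context {R : realType}.
Notation point := 'cV[R]_2.
Implicit Types (g n v w y : point) (a b c e s : R) (I : config) (X : 'I_3 -> point).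

Lemma is_derive_dot g (f : R -> point) v (x : R) :
  is_derive x (1 : R) f v -> is_derive x (1 : R) (fun e => dot g (f e)) (dot g v).
Proof.
move=> df; have [fd fE] := df.
have fi i : is_derive x (1 : R) (fun e => f e i ord0) (v i ord0).
  apply: DeriveDef; first by have := (derivable_mxP f x 1).1 fd; exact.
  by rewrite -fE derive_mx// mxE.
rewrite dotE (_ : (fun e => _) = (g ord0 ord0 \*: (fun e => f e ord0 ord0)) +
  (g ord_max ord0 \*: (fun e => f e ord_max ord0))).
  exact: is_deriveD.
by apply/funext => e; rewrite dotE.
Qed.

(** At 0 the derivative of [m] is multiplied by 0; hence the weights along the moving cut need only
    be derivable, and their derivative is never computed. *)
Lemma is_derive_mul_id (m : R -> R) (k : R) : derivable m 0 1 ->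
  is_derive (0 : R) (1 : R) (fun e => k - e * m e) (- m 0).
Proof.
move=> dm.
have h : is_derive (0 : R) (1 : R) (fun e : R => e * m e) (m 0).
  have := is_deriveM (is_derive_id 0 (1 : R)) (derivableP dm).
  by move/is_derive_eq; apply; rewrite /= scale0r add0r /GRing.scale/= mulr1.
have := is_deriveB (is_derive_cst k 0 (1 : R)) h.
by move/is_derive_eq; apply; rewrite sub0r.
Qed.

Lemma near_cuttable I a b c : cuttable I a b c ->
  \forall e \near (0 : R), cuttable I (a + e) b c.
Proof.
have near_neq0 (x : R) : x != 0 -> \forall e \near (0 : R), x + e != 0.
  move=> x0; near=> e.
  have ex : `|e| < `|x|.
    near: e; have x0' : 0 < `|x| by rewrite normr_gt0.
    exact: (@nbhs0_lt _ R^o _ x0').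
  by apply: contraTN ex => /eqP/(canRL (addrK _)) ->; rewrite sub0r normrN ltxx.
rewrite /cuttable /pivot; case: I => -[] t /= /andP[h1 h2].
- near=> e; rewrite -!addrA !(addrC e) !addrA; apply/andP; split; near: e;
    exact: near_neq0.
- near=> e; rewrite h2 andbT -opprB oppr_eq0 -addrA (addrC e) addrA; near: e.
  by apply: near_neq0; rewrite -opprB oppr_eq0.
- near=> e; rewrite h2 andbT -opprB oppr_eq0 -addrA (addrC e) addrA; near: e.
  by apply: near_neq0; rewrite -opprB oppr_eq0.
Unshelve. all: by end_near. Qed.

Lemma derivable_bary1 I a b c s : cuttable I a b c ->
  derivable (fun e : R => (1 - s) * (bary I (a + e) b c v1).1
                         + s * (bary I (a + e) b c v1).2) 0 1.
Proof.
have D (k x : R) : x != 0 -> derivable (fun e : R => k / (x + e)) 0 1.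
  move=> x0; apply: derivableM; first exact: derivable_cst.
  apply: derivableV; first by rewrite addr0.
  by apply: derivableD; [exact: derivable_cst|exact: derivable_id].
rewrite /cuttable /bary /pivot; case: I => -[] t /= /andP[h1 h2].
- rewrite (_ : (fun e => _) = (fun e => ((1 - s) * - b) / (a - b + e)) +
    (fun e => (s * - c) / (a - c + e))).
    by apply: derivableD; apply: D.
  by apply/funext => e; rewrite !mulrA !(addrAC a e).
- rewrite (_ : (fun e => _) = (fun e => ((1 - s) * - b) / (a - b + e))).
    by apply: D; rewrite -opprB oppr_eq0.
  apply/funext => e; rewrite mulr0 addr0 -mulrA -[a - b + e]opprK invrN.
  by rewrite mulrNN; congr (_ * (_ / _)); ring.
- rewrite (_ : (fun e => _) = (fun e => ((1 - s) * - c) / (a - c + e))).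
    by apply: D; rewrite -opprB oppr_eq0.
  apply/funext => e; rewrite mulr0 addr0 -mulrA -[a - c + e]opprK invrN.
  by rewrite mulrNN; congr (_ * (_ / _)); ring.
Qed.

(* phi_eps, the affine function with nodal values a + eps, b, c, vanishes at
   the ends of its cut, so phi = - eps * hat_k along the moving cut. *)
Lemma velocity_dot X I g (c0 : R) a b c s v :
  dot g (X v1) + c0 = a -> dot g (X v2) + c0 = b -> dot g (X v3) + c0 = c ->
  cuttable I a b c ->
  is_derive (0 : R) (1 : R)
    (fun e => seg (ends X I (a + e) b c).1 (ends X I (a + e) b c).2 s) v ->
  dot g v = - ((1 - s) * (bary I a b c v1).1 + s * (bary I a b c v1).2).
Proof.
move=> h1 h2 h3 cut /(is_derive_dot g) dv.
pose m e := (1 - s) * (bary I (a + e) b c v1).1 + s * (bary I (a + e) b c v1).2.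
have dm := is_derive_mul_id (- c0) (@derivable_bary1 I a b c s cut).
have E : \forall e \near (0 : R), - c0 - e * m e =
  dot g (seg (ends X I (a + e) b c).1 (ends X I (a + e) b c).2 s).
  near=> e.
  have cute : cuttable I (a + e) b c by near: e; exact: near_cuttable.
  have [E1 E2] := ends_affine X g c0 cute.
  have [Z1 Z2] := bary_zero cute.
  rewrite dot_seg /m.
  have o1 : ord0 = v1 by apply: val_inj.
  have o2 : lift ord0 ord0 = v2 by apply: val_inj.
  have o3 : lift ord0 (lift ord0 ord0) = v3 by apply: val_inj.
  move: E1 E2; rewrite !big_ord_recl !big_ord0 o2 o3 o1 h1 h2 h3.
  move: (bary I (a + e) b c) Z1 Z2 => B Z1 Z2 E1 E2.
  have {}E1 : dot g (ends X I (a + e) b c).1 = - c0 - e * (B v1).1 by lra.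
  have {}E2 : dot g (ends X I (a + e) b c).2 = - c0 - e * (B v1).2 by lra.
  by rewrite E1 E2; ring.
have dm' := near_eq_is_derive E dm.
have [_ <-] := dv; have [_ ->] := dm'.
by rewrite addr0.
Unshelve. all: by end_near. Qed.

Lemma derive_affine (f : point -> R) g (c0 : R) y v :
  (\forall z \near y, f z = dot g z + c0) -> 'D_v f y = dot g v.
Proof.
move=> fE; have fy := nbhs_singleton fE.
have cv : (fun h : R => h *: v + y) @ (0 : R) --> y.
  rewrite -[X in _ --> X]add0r -(scale0r v).
  by apply: cvgD; [apply: cvgZr_tmp; exact: cvg_id|exact: cvg_cst].
have fh : \forall h \near (0 : R), f (h *: v + y) = dot g (h *: v + y) + c0.
  exact: cv _ fE.
apply/cvg_lim => //; apply: cvg_near_cst; near=> h.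
have h0 : h != 0 by near: h; exact: nbhs_dnbhs_neq.
have fhE : f (h *: v + y) = dot g (h *: v + y) + c0.
  by near: h; exact: nbhs_dnbhs.
rewrite /= fhE fy !dot_linE (_ : _ - _ = h * dot g v); last by ring.
by rewrite /GRing.scale/= mulKf.
Unshelve. all: by end_near. Qed.

Lemma grad_affine (f : point -> R) g (c0 : R) y :
  (\forall z \near y, f z = dot g z + c0) -> grad f y = g.
Proof.
move=> fE; apply/matrixP => i j; rewrite (ord1 j) mxE (derive_affine _ fE).
by rewrite dotE !mxE; case: i => [[|[|//]] hi];
  rewrite /= !(mulr1, mulr0, addr0, add0r); congr (g _ _); apply: val_inj.
Qed.
End Velocity.

(** * Openness of triangles *)

Section OpenTriangle.
Context {R : realType}.
Notation point := 'cV[R]_2.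

Lemma continuous_affine (g : point) (c0 : R) :
  continuous (fun y : point => dot g y + c0).
Proof.
move=> y.
have cc (i j : 'I__) : (fun z : point => z i j : R^o) @ y --> (y i j : R^o).
    exact: coord_continuous.
have FF : Filter (nbhs y) by exact: nbhs_filter.
have c1 (i j : 'I__) := @cvgM _ _ _ FF _ _ _ _
  (cvg_cst (FF := FF) (g i j : R^o)) (cc i j).
have c2 := @cvgD _ _ _ _ FF _ _ _ _
  (@cvgD _ _ _ _ FF _ _ _ _ (c1 ord0 ord0) (c1 ord_max ord0))
  (cvg_cst (FF := FF) (c0 : R^o)).
rewrite /continuous_at dotE.
rewrite (_ : (fun y : point => _) =
  (fun y : point =>
     g ord0 ord0 * y ord0 ord0 + g ord_max ord0 * y ord_max ord0 + c0)).
exact: c2.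
by apply/funext => z; rewrite dotE.
Qed.

Lemma open_affine_gt0 (g : point) (c0 : R) :
  open [set y : point | 0 < dot g y + c0].
Proof.
have /continuousP := @continuous_affine g c0.
by move=> /(_ _ (@open_gt R 0)).
Qed.

(** An intersection of three open half-planes: [g2] and [g3] are the gradients of the second and
    third barycentric coordinates, given by Cramer's rule. *)
Lemma open_open_triangle (X1 X2 X3 : point) : \det (jac X1 X2 X3) != 0 ->
  open (open_triangle X1 X2 X3).
Proof.
set D := \det _ => D0.
have DE := det_jac X1 X2 X3; rewrite -/D !mxE in DE.
pose g2 : point := \col_i (if i == ord0 then (X3 ord_max ord0 - X1 ord_max ord0) / D
                                        else - (X3 ord0 ord0 - X1 ord0 ord0) / D).
pose g3 : point := \col_i (if i == ord0
                           then - (X2 ord_max ord0 - X1 ord_max ord0) / D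
                                        else (X2 ord0 ord0 - X1 ord0 ord0) / D).
have E2 y : dot g2 y - dot g2 X1 =
  ((y ord0 ord0 - X1 ord0 ord0) * (X3 ord_max ord0 - X1 ord_max ord0)
   - (y ord_max ord0 - X1 ord_max ord0) * (X3 ord0 ord0 - X1 ord0 ord0)) / D.
  by rewrite !dotE !mxE/=; ring.
have E3 y : dot g3 y - dot g3 X1 =
  ((y ord_max ord0 - X1 ord_max ord0) * (X2 ord0 ord0 - X1 ord0 ord0)
   - (y ord0 ord0 - X1 ord0 ord0) * (X2 ord_max ord0 - X1 ord_max ord0)) / D.
  by rewrite !dotE !mxE/=; ring.
rewrite (_ : open_triangle X1 X2 X3 =
  [set y | 0 < dot (- g2 - g3) y + (1 + dot g2 X1 + dot g3 X1)] `&`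
  ([set y | 0 < dot g2 y + (- dot g2 X1)] `&`
   [set y | 0 < dot g3 y + (- dot g3 X1)])).
  by apply: openI; [|apply: openI]; exact: open_affine_gt0.
have E1 y : dot (- g2 - g3) y + (1 + dot g2 X1 + dot g3 X1) =
    1 - (dot g2 y - dot g2 X1) - (dot g3 y - dot g3 X1).
  by rewrite dotC !dot_linE !(dotC y); ring.
rewrite eqEsubset; split => y /=; rewrite E1.
- move=> [t1 [t2 [t3 [t10 t20 t30 tsum yE]]]].
  have E : dot g2 y - dot g2 X1 = t2 /\ dot g3 y - dot g3 X1 = t3.
    have t1E : t1 = 1 - t2 - t3 by rewrite -tsum; ring.
    rewrite E2 E3 yE t1E !mxE; split; apply: (mulIf D0); rewrite divfK// DE; ring.
  by rewrite E.1 E.2; split; [lra|].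
- move=> [h1 [h2 h3]].
  exists (1 - (dot g2 y - dot g2 X1) - (dot g3 y - dot g3 X1)),
    (dot g2 y - dot g2 X1), (dot g3 y - dot g3 X1); split => //; first by ring.
  have barD e2 e3 a b c : ((1 - e2 / D - e3 / D) * a + e2 / D * b + e3 / D * c) * D
      = a * D + e2 * (b - a) + e3 * (c - a) by field.
  by rewrite E2 E3; apply: point_eqP; apply: (mulIf D0);
    rewrite !mxE barD DE; ring.
Qed.

End OpenTriangle.

(** * Triangles of the mesh and their local vertices *)

Section MeshGeometry.

Lemma ord3P (i : 'I_3) : i = v1 \/ i = v2 \/ i = v3.
Proof.
by case: i => [[|[|[|//]]] hi]; [left|right; left|right; right]; exact: val_inj.
Qed.

Lemma sum_ord3 (V : nmodType) (F : 'I_3 -> V) :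
  \sum_j F j = F v1 + F v2 + F v3.
Proof.
rewrite !big_ord_recl big_ord0 addr0 addrA.
by congr (F _ + F _ + F _); exact: val_inj.
Qed.

Context {R : realType}.
Variable T : mesh R.
Implicit Types (k i : 'I_(nnodes T)) (l : 'I_(ntri T)).

(** Two equal vertices would make the positive determinant vanish. *)
Lemma vert_inj l : injective (vert l).
Proof.
have := vert_ccw l; rewrite det_jac => D.
have n12 : vert l v1 <> vert l v2.
  by move=> E; move: D; rewrite E !mxE !subrr !mul0r subrr ltxx.
have n13 : vert l v1 <> vert l v3.
  by move=> E; move: D; rewrite E !mxE !subrr !mulr0 subrr ltxx.
have n23 : vert l v2 <> vert l v3.
  by move=> E; move: D; rewrite E !mxE [X in _ - X]mulrC subrr ltxx.
move=> i j; have [->|[->|->]] := ord3P i; have [->|[->|->]] := ord3P j => // E;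
  by [case: n12|case: n13|case: n23].
Qed.

Lemma loc_inj k l : injective (loc k l).
Proof. by move=> i j /vert_inj /addrI. Qed.

Lemma verts_loc k l : verts l = [set loc k l j | j : 'I_3]%SET.
Proof.
apply/setP => i; apply/imsetP/imsetP => -[j _ ->]; last by eexists.
exists (j - odflt v1 [pick i | vert l i == k]) => //.
by rewrite /loc addrC subrK.
Qed.

Lemma sum_verts (V : zmodType) k l (G : 'I_(nnodes T) -> V) :
  (forall i, i \notin verts l -> G i = 0) -> \sum_i G i = \sum_j G (loc k l j).
Proof.
move=> G0; rewrite (bigID (fun i => i \in verts l))/= [X in _ + X]big1 ?addr0//.
rewrite (verts_loc k l) big_imset/=; last by move=> i j _ _; exact: loc_inj.
by apply: eq_bigl => j; rewrite inE.
Qed.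

Lemma tri_open_triangle k l :
  tri l = open_triangle (locx k l v1) (locx k l v2) (locx k l v3).
Proof.
rewrite eqEsubset; split => y.
- move=> [w [w_gt0 w0 w1 ->]].
  have wloc j : 0 < w (loc k l j).
    by apply: w_gt0; rewrite (verts_loc k l); apply/imsetP; exists j.
  exists (w (loc k l v1)), (w (loc k l v2)), (w (loc k l v3)); split => //.
    by rewrite -(sum_ord3 (w \o loc k l)) -(sum_verts k w0).
  rewrite -(sum_ord3 (fun j => w (loc k l j) *: locx k l j)).
  by rewrite (@sum_verts _ k l)// => i /w0 ->; rewrite scale0r.
- move=> [t1 [t2 [t3 [t10 t20 t30 tsum ->]]]].
  pose t (j : 'I_3) := tnth [tuple t1; t2; t3] j.
  (* At most one term, as [loc] is injective: this extends the three weights by zero without an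
     inverse of [loc]. *)
  pose w i := \sum_(j | loc k l j == i) t j.
  have wE j : w (loc k l j) = t j.
    by rewrite /w (big_pred1 j)// => j'; rewrite (inj_eq (@loc_inj k l)).
  have w0 i : i \notin verts l -> w i = 0.
    move=> iN; rewrite /w big_pred0// => j; apply: contraNF iN => /eqP <-.
    by rewrite (verts_loc k l); apply/imsetP; exists j.
  exists w; split => //.
  + move=> i; rewrite (verts_loc k l) => /imsetP[j _ ->]; rewrite wE.
    by have [->|[->|->]] := ord3P j.
  + by rewrite (sum_verts k w0) sum_ord3 !wE.
  + rewrite (@sum_verts _ k l) ?sum_ord3 ?wE//.
    by move=> i /w0 ->; rewrite scale0r.
Qed.

Lemma vertex_tri_bar k l j : tri_bar l (locx k l j).
Proof.
exists (fun i => (i == loc k l j)%:R); split.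
- by move=> i; rewrite ler0n.
- move=> i; apply: contraNeq; rewrite (verts_loc k l) pnatr_eq0 eqb0 negbK.
  by move=> /eqP ->; apply/imsetP; exists j.
- by rewrite (bigD1 (loc k l j))//= eqxx big1 ?addr0// => i /negPf ->.
- by rewrite (bigD1 (loc k l j))//= eqxx scale1r big1 ?addr0// => i /negPf ->;
     rewrite scale0r.
Qed.

Lemma tri_sub_tri_bar l : tri l `<=` tri_bar l.
Proof.
move=> y [w [w1 w2 w3 w4]]; exists w; split => // i.
by have [/w1/ltW//|/w2 ->] := boolP (i \in verts l).
Qed.

(** [loc] only rotates the vertices cyclically, which preserves the determinant. *)
Lemma det_J_gt0 k l : 0 < \det (J k l).
Proof.
have := vert_ccw l; rewrite /J /locx /loc; set i0 := odflt _ _.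
have e12 : v1 + v2 = v2 :> 'I_3 by exact: val_inj.
have e13 : v1 + v3 = v3 :> 'I_3 by exact: val_inj.
have e11 : v1 + v1 = v1 :> 'I_3 by exact: val_inj.
have e22 : v2 + v2 = v3 :> 'I_3 by exact: val_inj.
have e23 : v2 + v3 = v1 :> 'I_3 by exact: val_inj.
have e33 : v3 + v3 = v2 :> 'I_3 by exact: val_inj.
have [->|[->|->]] := ord3P i0;
  rewrite ?(e12, e13, e11, e22, e23, e33);
  rewrite ?((addrC v2 v1), (addrC v3 v1), (addrC v3 v2)) ?(e12, e13, e23);
  by rewrite !det_jac !mxE => /lt_le_trans; apply; rewrite le_eqVlt; apply/orP; left;
     apply/eqP; ring.
Qed.

Lemma loc_v1 k l : k \in verts l -> loc k l v1 = k.
Proof.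
move=> /imsetP[j _ kE]; rewrite /loc.
case: pickP => [i /eqP <-|/(_ j)]; last by rewrite -kE eqxx.
by congr vert; rewrite /= (_ : v1 = 0) ?addr0//; exact: val_inj.
Qed.

Lemma open_tri l : open (tri l).
Proof.
rewrite (tri_open_triangle (vert l v1) l); apply: open_open_triangle.
by rewrite gt_eqF// det_J_gt0.
Qed.

Lemma tri_sub_dom l : tri l `<=` dom T.
Proof.
rewrite /dom -open_subsetE; last exact: open_tri.
by move=> y /tri_sub_tri_bar yl; exists l.
Qed.

(* Otherwise conformity would put x_k on the opposite edge of a triangle having
   x_k as a vertex. *)
Lemma vertex_of_I k l : I_ k l -> k \in verts l.
Proof.
move=> kl; apply/negPn/negP => kNl; have [l' kl'] := node_used k.
have : (hull (@node R T) (verts l) `&` hull (@node R T) (verts l')) (node k).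
  split => //; have := kl'; rewrite {1}(verts_loc k l') => /imsetP[j _ kE].
  by have := vertex_tri_bar k l' j; rewrite /locx -kE.
rewrite mesh_conforming => -[w [w0 wN w1 wE]].
have k1 := loc_v1 kl'.
have wk : w (loc k l' v1) = 0 by apply: wN; rewrite k1 inE negb_and kNl.
have w0' i : i \notin verts l' -> w i = 0.
  by move=> iN; apply: wN; rewrite inE negb_and iN orbT.
have := det_J_gt0 k l'; rewrite /J det_jac.
have x1E : locx k l' v1 = w (loc k l' v2) *: locx k l' v2
                        + w (loc k l' v3) *: locx k l' v3.
  rewrite /locx {1}k1 wE (@sum_verts _ k l') ?sum_ord3 ?wk ?scale0r ?add0r//.
  by move=> i /w0' ->; rewrite scale0r.
have w3 : w (loc k l' v3) = 1 - w (loc k l' v2).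
  by rewrite -w1 (sum_verts k w0') sum_ord3 wk; ring.
by rewrite x1E w3 !mxE; apply/negP; rewrite -leNgt le_eqVlt; apply/orP; left;
  apply/eqP; ring.
Qed.

End MeshGeometry.

(** * The element stiffness matrix as a product of gradients *)

Section Stiffness.
Context {R : realType}.
Notation point := 'cV[R]_2.

Lemma gradpsiE (j : 'I_3) : gradpsi j =
  tnth [tuple const_mx (-1); delta_mx ord0 ord0; delta_mx ord_max ord0] j
  :> point.
Proof.
rewrite /gradpsi; apply: (@grad_affine _ _ _ (j == v1)%:R).
near=> z; rewrite dotE.
by have [->|[->|->]] := ord3P j; rewrite /psi !(tnth_nth 0) /= !mxE/=; ring.
Unshelve. all: by end_near. Qed.

Lemma mul_tr_point (A : 'M[R]_2) (g : point) i :
  (A^T *m g) i ord0 = A ord0 i * g ord0 ord0 + A ord_max i * g ord_max ord0.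
Proof.
have l1 : lift ord0 ord0 = ord_max :> 'I_2 by exact: val_inj.
by rewrite mxE !big_ord_recl big_ord0 addr0 l1 !mxE.
Qed.

(** The vectors [h j] are the gradients of the three hat functions on the triangle: combined with
    nodal values they give back the gradient, the constants dropping out because they sum to 0. *)
Lemma bil3_k0 (X : 'I_3 -> point) (gu gp : point) (ku kp : R) :
  let Jl := jac (X v1) (X v2) (X v3) in \det Jl != 0 ->
  bil3 (\col_j (dot gp (X j) + kp)) (k0 Jl) (\col_j (dot gu (X j) + ku)) =
  dot gu gp.
Proof.
move=> Jl J0; pose h j : point := (invmx Jl)^T *m gradpsi j.
have Ju : Jl \in unitmx by rewrite unitmxE unitfE.
have lift g (kg : R) : \sum_j (dot g (X j) + kg) *: h j = g.
  transitivity ((invmx Jl)^T *m (Jl^T *m g)); last first.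
    by rewrite mulmxA -trmx_mul mulmxV// trmx1 mul1mx.
  under eq_bigr do rewrite /h scalemxAr.
  rewrite -mulmx_sumr; congr (_ *m _).
  rewrite sum_ord3 !gradpsiE !(tnth_nth 0) /=.
  by apply: point_eqP; rewrite mul_tr_point !jac_col !mxE !dotE/=; ring.
rewrite -[in RHS](lift gu ku) -[in RHS](lift gp kp) !sum_ord3.
rewrite /bil3 !mxE !sum_ord3 !mxE !sum_ord3 !mxE -!/(h _).
by move: (h v1) (h v2) (h v3) => h1 h2 h3; rewrite !dotE !mxE; ring.
Qed.

End Stiffness.

(** * The interface as a zero set, and the signs behind a configuration *)

Section Interface.
Context {R : realType}.
Variable T : mesh R.
Notation point := 'cV[R]_2.
Implicit Types (k i : 'I_(nnodes T)) (l : 'I_(ntri T)) (phi : point -> R).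

Lemma interface_zero phi l y : is_level_set_function T phi ->
  interface phi l y -> tri l y /\ phi y = 0.
Proof.
by move=> [_ h] [ly by_]; split => //; apply: h => //; exact: tri_sub_dom ly.
Qed.

Lemma interface_disjoint phi l l' y :
  interface phi l y -> interface phi l' y -> l = l'.
Proof.
move=> [ly _] [l'y _]; apply/eqP/negPn/negP => /tri_disjoint E.
by have : set0 y by rewrite -E.
Qed.

Lemma near_line (y v : point) (A : set point) : nbhs y A ->
  \forall t \near (0 : R)^'+, A (y - t *: v).
Proof.
have cv : (fun t : R => y - t *: v) @ (0 : R) --> y.
  rewrite -[X in _ --> X]subr0 -(scale0r v).
  by apply: cvgB; [exact: cvg_cst|apply: cvgZr_tmp; exact: cvg_id].
by move=> Ay; exact: cvg_at_right_filter cv _ Ay.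
Qed.

(** A zero [y] is not in [Omega], hence not interior to it, but the points [y - t g] with small
    [t > 0] are in [Omega]. *)
Lemma zero_interface phi l (g : point) (c0 : R) y : g != 0 ->
  (forall z, tri_bar l z -> phi z = dot g z + c0) ->
  tri l y -> phi y = 0 -> interface phi l y.
Proof.
move=> g0 phiE ly y0; split => //; split; last first.
  by move=> /interior_subset [_]; rewrite y0 ltxx.
move=> B yB.
have yl : nbhs y (tri l) by apply: open_nbhs_nbhs; split => //; exact: open_tri.
have /filter_ex[t [t0 [tl tB]]] : \forall t \near (0 : R)^'+,
    0 < t /\ (tri l (y - t *: g) /\ B (y - t *: g)).
  near=> t; split; [|split]; near: t; [exact: nbhs_right_gt|exact: near_line|].
  exact: near_line.
exists (y - t *: g); split => //; split; first exact: tri_sub_dom tl.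
rewrite phiE; last exact: tri_sub_tri_bar.
rewrite !dot_linE addrAC -(phiE y) ?y0; last exact: tri_sub_tri_bar.
by rewrite add0r oppr_lt0 mulr_gt0// dot_gt0.
Unshelve. all: by end_near. Qed.

Lemma at_right_ex (P : R -> Prop) :
  (\forall t \near (0 : R)^'+, P t) -> exists t, 0 < t /\ P t.
Proof.
move=> nP; apply: (@filter_ex _ (0 : R)^'+).
by near=> t; split; near: t => //; exact: nbhs_right_gt.
Unshelve. all: by end_near. Qed.

(** For [0 < e < |a|] adding [e] cannot change the sign of [a]; at [a = 0] only the weak inequality
    survives. *)
Lemma near_sg (a t : R) :
  (\forall e \near (0 : R)^'+, Num.sg (a + e) = t) -> 0 <= t * a.
Proof.
move=> h; rewrite leNgt; apply/negP => ta.
have a0 : 0 < `|a|.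
  by rewrite normr_gt0; apply: contraTneq ta => ->; rewrite mulr0 ltxx.
have /filter_ex[e [e0 [ea et]]] : \forall e \near (0 : R)^'+,
    0 < e /\ (e < `|a| /\ Num.sg (a + e) = t).
  near=> e; split; [|split]; near: e => //;
    [exact: nbhs_right_gt|exact: nbhs_right_lt].
move: ta; rewrite -et; have [a_lt0|a_gt0|->] := ltgtP a 0.
- rewrite (ltr0_norm a_lt0) in ea; rewrite ltr0_sg; last by lra.
  by rewrite mulN1r; lra.
- by rewrite gtr0_sg ?mul1r; lra.
- by rewrite mulr0 ltxx.
Unshelve. all: by end_near. Qed.

(* A^+ allows phi (x_k) = 0; the interface of phi then misses the triangle. *)
Lemma has_config_cases hat phi k l I : is_hat_basis hat -> I_ k l ->
  has_config hat phi k l I ->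
  let a := phi (locx k l v1) in
  let b := phi (locx k l v2) in
  let c := phi (locx k l v3) in
  compatible I a b c \/
  [/\ I.1 = cutA, a = 0, sigma R I * b < 0 & sigma R I * c < 0].
Proof.
move=> [_ hatE] kl cfg a b c.
have k1 := loc_v1 (vertex_of_I kl).
have S1 e : Sop hat phi k e (locx k l v1) = a + e.
  by rewrite /Sop /locx k1 hatE eqxx mulr1 /a /locx k1.
have Sj e j : j != v1 -> Sop hat phi k e (locx k l j) = phi (locx k l j).
  move=> j1; rewrite /Sop /locx hatE -[X in X == _]k1 (inj_eq (@loc_inj _ _ k l)).
  by rewrite eq_sym (negPf j1) mulr0 addr0.
have sg_gt0 (t x : R) : t != 0 -> Num.sg x = t -> 0 < t * x.
  by move=> t0 xt; rewrite -xt -normrEsg normr_gt0 -sgr_eq0 xt.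
have s0 : sigma R I != 0.
  by rewrite /sigma; case: I.2; rewrite ?oppr_eq0 oner_eq0.
have sN0 : - sigma R I != 0 by rewrite oppr_eq0.
move: cfg; rewrite /has_config /compatible; case: I.1 => cfg.
- have [e [_ [e1 e2 e3]]] := at_right_ex cfg.
  have sa : 0 <= sigma R I * a.
    apply: near_sg.
    by apply: filterS cfg => e' [<- _ _]; rewrite S1.
  rewrite (Sj _ v2)// in e2; rewrite (Sj _ v3)// in e3.
  have := sg_gt0 _ _ sN0 e2; have := sg_gt0 _ _ sN0 e3.
  rewrite !mulNr !oppr_gt0 => h3 h2.
  have [->|a0] := eqVneq a 0; [by right; split|left; split => //].
  by rewrite lt_neqAle sa eq_sym mulf_neq0.
- have [e [_ [e1 e2 e3]]] := at_right_ex cfg.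
  have sa : 0 <= - sigma R I * a.
    apply: near_sg.
    by apply: filterS cfg => e' [<- _ _]; rewrite S1.
  rewrite (Sj _ v2)// in e2; rewrite (Sj _ v3)// in e3.
  have := sg_gt0 _ _ s0 e2; have := sg_gt0 _ _ sN0 e3.
  by rewrite !mulNr !oppr_gt0 => h3 h2; left; split => //; lra.
- have [e [_ [e1 e2 e3]]] := at_right_ex cfg.
  have sa : 0 <= - sigma R I * a.
    apply: near_sg.
    by apply: filterS cfg => e' [<- _ _]; rewrite S1.
  rewrite (Sj _ v2)// in e2; rewrite (Sj _ v3)// in e3.
  have := sg_gt0 _ _ sN0 e2; have := sg_gt0 _ _ s0 e3.
  by rewrite !mulNr !oppr_gt0 => h3 h2; left; split => //; lra.
Qed.

End Interface.

(** * Normal, gradients and nodal forms on one triangle *)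

Section Element.
Context {R : realType}.
Variable T : mesh R.
Notation point := 'cV[R]_2.
Implicit Types (k i : 'I_(nnodes T)) (l : 'I_(ntri T)) (phi u p : point -> R).

Lemma param_ends phi k l I (e s : R) :
  let E := ends (locx k l) I (phi (locx k l v1) + e) (phi (locx k l v2))
             (phi (locx k l v3)) in
  param phi k l I e s = seg E.1 E.2 s.
Proof. by rewrite /param /ends; case: I.1. Qed.

Lemma grad_on_tri u l (g : point) (c0 : R) y :
  (forall z, tri_bar l z -> u z = dot g z + c0) -> tri l y -> grad u y = g.
Proof.
move=> uE ly; apply: (@grad_affine _ _ _ c0).
have yl : nbhs y (tri l) by apply: open_nbhs_nbhs; split => //; exact: open_tri.
by apply: filterS yl => z /tri_sub_tri_bar/uE.
Qed.

Lemma outer_normalE phi n l (g P Q : point) (c0 : R) y :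
  is_outer_normal T phi n -> P != Q ->
  (forall z, tri_bar l z -> phi z = dot g z + c0) ->
  interface phi l = open_segment P Q -> (forall z, interface phi l z -> phi z = 0) ->
  interface phi l y -> n y = (enorm g)^-1 *: g.
Proof.
move=> hn PQ phiE SE zero ly; have [n1 orth inside _] := hn _ _ ly.
have := ly; rewrite SE => -[s s01 yE].
(* A second interface point turns the chord conditions into orthogonality to [Q - P]. *)
have lz : interface phi l (seg P Q (s / 2)) by rewrite SE; exists (s / 2) => //; lra.
have zyE : seg P Q (s / 2) - y = (s / 2 - s) *: (Q - P) by rewrite yE segB.
have c_neq0 : s / 2 - s != 0 by apply/eqP; lra.
have tz z : interface phi l z -> tri_bar l z.
  by move=> [/tri_sub_tri_bar].
apply: (@parallel_unit_normal _ _ _ (Q - P)) => //.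
- by rewrite subr_eq0 eq_sym.
- apply: (mulfI c_neq0); rewrite mulr0 -dotZr -zyE dotDr dotNr.
  have := zero _ ly; have := zero _ lz; rewrite !phiE; [lra|exact: tz..].
- by apply: (mulfI c_neq0); rewrite mulr0 -dotZr -zyE orth.
- have yl : nbhs y (tri l).
    by apply: open_nbhs_nbhs; split; [exact: open_tri|case: ly].
  (* A point slightly inside [Omega] and still in the triangle, where [phi] is affine, yields
     [g . n > 0]. *)
  have /at_right_ex[t [t0 [[_ tO] tl]]] : \forall t \near (0 : R)^'+,
      Omega T phi (y - t *: n y) /\ tri l (y - t *: n y).
    by near=> t; split; near: t; [exact: inside|exact: near_line].
  move: tO; rewrite phiE; last exact: tri_sub_tri_bar.
  have := zero _ ly; rewrite phiE; last exact: tz.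
  rewrite !dot_linE => yz; rewrite addrAC yz add0r oppr_lt0.
  by rewrite pmulr_rgt0.
Unshelve. all: by end_near. Qed.

Definition nodal_pair I (a b c : R) (f : 'I_3 -> R) : R * R :=
  (\sum_j f j * (bary I a b c j).1, \sum_j f j * (bary I a b c j).2).

Lemma dot3_fbar I (a b c : R) (p : 'I_3 -> R) : cuttable I a b c ->
  dot3 (\col_j p j) (fbar I a b c) =
  - kappa I a b c * int2 (bary I a b c v1) (nodal_pair I a b c p).
Proof.
move=> cut; rewrite /dot3 mxE sum_ord3 !mxE !fbarE//.
rewrite /nodal_pair !sum_ord3 /int2 /=.
move: (bary _ _ _ _ _) (bary _ _ _ _ _) (bary _ _ _ _ _) => x y z.
by field.
Qed.

Lemma bil3_mbar I (a b c : R) (p u : 'I_3 -> R) : cuttable I a b c ->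
  bil3 (\col_j p j) (mbar I a b c) (\col_j u j) =
  - kappa I a b c * int3 (bary I a b c v1) (nodal_pair I a b c p)
                         (nodal_pair I a b c u).
Proof.
move=> cut; rewrite /bil3 mxE sum_ord3 !mxE !sum_ord3 !mxE !mbarE//.
rewrite /nodal_pair !sum_ord3 /int3 /=.
move: (bary I a b c v1) (bary I a b c v2) (bary I a b c v3) => x y z.
by field.
Qed.

End Element.

(** * The identity on one triangle with a cut configuration *)

Section CutElement.
Context {R : realType}.
Variable T : mesh R.
Notation point := 'cV[R]_2.
Implicit Types (k i : 'I_(nnodes T)) (l : 'I_(ntri T)) (phi u p : point -> R).

Lemma nodal_affine k l u (g : point) (c0 : R) :
  (forall z, tri_bar l z -> u z = dot g z + c0) ->
  nodal k l u = \col_j (dot g (locx k l j) + c0).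
Proof.
by move=> uE; apply/colP => j; rewrite !mxE uE//; exact: vertex_tri_bar.
Qed.

Lemma cut_element hat phi k l I (V n : point -> point) u p uhat
    (dlam dal df dalt c2 : R) :
  is_hat_basis hat -> Sh1 T phi -> Sh1 T u -> Sh1 T p -> Sh1 T uhat ->
  is_level_set_function T phi -> is_outer_normal T phi n ->
  I_ k l -> has_config hat phi k l I ->
  (forall s : R, 0 <= s <= 1 -> interface phi l (param phi k l I 0 s) ->
     is_derive (0 : R) (1 : R) (fun e : R => param phi k l I e s)
       (V (param phi k l I 0 s))) ->
  segment_integral (interface phi l)
    (fun y => Lh 0 c2 dlam dal dalt df u p uhat n y * dot (V y) (n y)) =
  dlam * (bil3 (nodal k l p) (k0 (J k l)) (nodal k l u) * dka phi k I l)
  + dal * bil3 (nodal k l p) (dkm phi k I l) (nodal k l u)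
  - df * dot3 (nodal k l p) (dkf phi k I l)
  + c2 * dalt * bil3 (nodal k l u - nodal k l uhat) (dkm phi k I l)
                     (nodal k l u - nodal k l uhat)
  - 2 * dlam * (on_interface phi l (fun y => dot (grad u y) (n y))
                * on_interface phi l (fun y => dot (grad p y) (n y))
                * dka phi k I l).
Proof.
move=> hhat [_ /(_ l)[g [c0 phiE]]] [_ /(_ l)[gu [cu uE]]] [_ /(_ l)[gp [cp pE]]]
  [_ /(_ l)[gh [ch hE]]] hlevel hn kl hI hV.
pose X := locx k l.
have Xl j : tri_bar l (X j) by exact: vertex_tri_bar.
have zero y : interface phi l y -> phi y = 0 by move=> /(interface_zero hlevel)[].
have := has_config_cases hhat kl hI => /=.
set a := phi (locx k l v1); set b := phi (locx k l v2); set c := phi (locx k l v3).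
have ha : dot g (X v1) + c0 = a by rewrite -phiE.
have hb : dot g (X v2) + c0 = b by rewrite -phiE.
have hc : dot g (X v3) + c0 = c by rewrite -phiE.
pose D := \det (J k l); have D0 : 0 < D by exact: det_J_gt0.
have Dn : `|D| = D by rewrite gtr0_norm.
pose w := nodal_pair I a b c.
pose U j := dot gu (X j) + cu; pose P j := dot gp (X j) + cp.
pose W j := dot (gu - gh) (X j) + (cu - ch).
pose psi1 := bary I a b c v1.
pose kap := kappa I a b c.
have nu : nodal k l u = \col_j U j by exact: nodal_affine.
have np : nodal k l p = \col_j P j by exact: nodal_affine.
have nw : nodal k l u - nodal k l uhat = \col_j W j.
  rewrite nu (nodal_affine k hE); apply/colP => j.
  by rewrite !mxE /U /W !dotE !mxE; ring.
have bil3Z (q v : 'cV[R]_3) (M : 'M[R]_3) t : bil3 q (t *: M) v = t * bil3 q M v.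
  by rewrite /bil3 -scalemxAr -scalemxAl mxE.
have dot3Z (q v : 'cV[R]_3) t : dot3 q (t *: v) = t * dot3 q v.
  by rewrite /dot3 -scalemxAr mxE.
rewrite nw nu np /dkm /dkf /dka -/D Dn -/a -/b -/c !bil3Z dot3Z.
(* Brings out the common factor [kap], which settles the degenerate case at once; [K1] and [K2]
   stand for the gradient products, constant on the triangle. *)
have rhs : cuttable I a b c -> forall K1 K2 : R,
  dlam * (K1 * (D * abar I a b c)) +
  dal * (D * bil3 (\col_j P j) (mbar I a b c) (\col_j U j)) -
  df * (D * dot3 (\col_j P j) (fbar I a b c)) +
  c2 * dalt * (D * bil3 (\col_j W j) (mbar I a b c) (\col_j W j)) -
  2 * dlam * (K2 * (D * abar I a b c)) =
  - (D * kap) * (c2 * dalt * int3 psi1 (w W) (w W) + dal * int3 psi1 (w P) (w U)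
    - df * int2 psi1 (w P) + (dlam * K1 - 2 * dlam * K2) * int1 psi1).
  move=> cut K1 K2; rewrite abarE// !bil3_mbar// dot3_fbar// -/kap -/w.
  by rewrite -/psi1; ring.
move=> [comp|[Ia a0 b0 c0']]; last first.
  rewrite rhs; last first.
    rewrite /cuttable /pivot Ia a0 !sub0r !oppr_eq0.
    by apply/andP; split; [apply: contraTneq b0|apply: contraTneq c0'] => ->;
      rewrite mulr0 ltxx.
  rewrite (_ : kap = 0); last by rewrite /kap /kappa /pivot Ia a0 mulr0 mul0r.
  (* The interface is empty: with [a = 0] and [b], [c] of one strict sign, [phi] has no zero in the
     open triangle. *)
  rewrite mulr0 oppr0 mul0r; apply: segment_integral0 => y iy; exfalso.
  have := zero _ iy; have [ly _] := interface_zero hlevel iy.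
  rewrite (phiE _ (tri_sub_tri_bar ly)).
  move: ly; rewrite (tri_open_triangle k) => -[t1 [t2 [t3 [t10 t20 t30 ts ->]]]].
  rewrite !dot_linE => y0.
  have : t1 * a + t2 * b + t3 * c = 0.
    by rewrite -ha -hb -hc -[RHS]y0 -[in RHS](mul1r c0) -ts /X; ring.
  rewrite a0 mulr0 add0r => /(congr1 ( *%R (sigma R I))).
  rewrite mulr0 mulrDr (mulrCA _ t2) (mulrCA _ t3).
  have := mulr_gt0 t20 (_ : 0 < - (sigma R I * b)).
  have := mulr_gt0 t30 (_ : 0 < - (sigma R I * c)).
  by rewrite !oppr_gt0 !mulrN => /(_ c0') h1 /(_ b0) h2; lra.
have cut := compatible_cuttable comp.
rewrite rhs//.
have kap0 : 0 < kap by exact: kappa_gt0.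
pose E := ends X I a b c.
(* A constant [phi] would have equal nodal values and zero denominators. *)
have g0 : g != 0.
  apply/eqP => g0; have [ab ac] : a = b /\ a = c.
    by split; [rewrite -ha -hb|rewrite -ha -hc]; rewrite g0 !dotE !mxE !mul0r.
  by move: cut; rewrite /cuttable /pivot -ab -ac; case: I.1; rewrite subrr eqxx.
have eg : 0 < enorm g by exact: enorm_gt0.
have dist : enorm (E.2 - E.1) = enorm g * (D * kap).
  by rewrite (ends_dist ha hb hc comp) -[\det _]/D Dn.
have E12 : E.1 != E.2.
  apply/eqP => E12; move: dist; rewrite E12 subrr.
  rewrite /enorm dotE !mxE !mul0r addr0 sqrtr0 => /eqP; apply/negP.
  by rewrite eq_sym gt_eqF// !mulr_gt0.
have SE : interface phi l = open_segment E.1 E.2.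
  rewrite -(zero_set_ends ha hb hc comp) -tri_open_triangle.
  rewrite eqEsubset; split => y.
    move=> iy; have [ly y0] := interface_zero hlevel iy.
    by split => //; rewrite -phiE//; exact: tri_sub_tri_bar.
  move=> [ly y0]; apply: (zero_interface g0 phiE ly).
  by rewrite phiE//; exact: tri_sub_tri_bar.
pose N := (enorm g)^-1 *: g.
have nE y : interface phi l y -> n y = N.
  by move=> iy; exact: (outer_normalE hn E12 phiE SE zero iy).
have iE s : 0 < s < 1 -> interface phi l (seg E.1 E.2 s).
  by move=> s01; rewrite SE; exists s.
have inE y : interface phi l y -> tri l y by case.
have onE f (gf : point) cf : (forall z, tri_bar l z -> f z = dot gf z + cf) ->
    on_interface phi l (fun y => dot (grad f y) (n y)) = dot gf N.
  move=> fE; rewrite /on_interface.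
  have ne : interface phi l !=set0.
    by exists (seg E.1 E.2 (1 / 2)); apply: iE; lra.
  rewrite asboolT//; case: xgetP => [y _ iy|none]; last first.
    by case: ne => z /none.
  by rewrite (nE _ iy) (grad_on_tri fE (inE _ iy)).
have k0E : bil3 (\col_j P j) (k0 (J k l)) (\col_j U j) = dot gu gp.
  exact: (@bil3_k0 _ X gu gp cu cp (lt0r_neq0 D0)).
rewrite k0E (onE u gu cu uE) (onE p gp cp pE).
set K := dlam * _ - _.
have affE (gf : point) cf s : dot gf (seg E.1 E.2 s) + cf =
    (1 - s) * (w (fun j => dot gf (X j) + cf)).1
    + s * (w (fun j => dot gf (X j) + cf)).2.
  have [e1 e2] := ends_affine X gf cf cut.
  by rewrite dot_seg /w /nodal_pair /= -e1 -e2 -/E; ring.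
have Vn s : 0 < s < 1 -> dot (V (seg E.1 E.2 s)) N =
    - ((1 - s) * psi1.1 + s * psi1.2) / enorm g.
  move=> s01.
  have pE0 : param phi k l I 0 s = seg E.1 E.2 s by rewrite param_ends addr0.
  have := hV s; rewrite pE0 => /(_ _ (iE s s01)) dV.
  rewrite dotC dotZl mulrC; congr (_ / _).
  apply: (velocity_dot ha hb hc cut (s := s)).
  have s01' : 0 <= s <= 1 by lra.
  move: (dV s01'); congr is_derive; apply/funext => e.
  exact: param_ends.
rewrite SE.
pose A (q : R * R) := q.1; pose B (q : R * R) := q.2 - q.1.
(* L_h = h0 + h1 s + h2 s^2 along the cut. *)
pose h0 := c2 * dalt * A (w W) ^+ 2 + dal * A (w U) * A (w P) - df * A (w P) + K.
pose h1 := 2 * c2 * dalt * A (w W) * B (w W)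
  + dal * (A (w U) * B (w P) + B (w U) * A (w P)) - df * B (w P).
pose h2 := c2 * dalt * B (w W) ^+ 2 + dal * B (w U) * B (w P).
(* Coefficients of the product of the affine factor [V . n] with the quadratic [L_h]. *)
rewrite (@segment_integral_cubic _ _ _ _
  (- A psi1 / enorm g * h0) (- (A psi1 * h1 + B psi1 * h0) / enorm g)
  (- (A psi1 * h2 + B psi1 * h1) / enorm g) (- B psi1 / enorm g * h2)
  E12); last first.
  move=> s s01; have iy := iE s s01; have ly := tri_sub_tri_bar (inE _ iy).
  rewrite (nE _ iy) Vn// /Lh (nE _ iy).
  rewrite (grad_on_tri uE (inE _ iy)) (grad_on_tri pE (inE _ iy)).
  have uhE : u (seg E.1 E.2 s) - uhat (seg E.1 E.2 s) =
      (1 - s) * (w W).1 + s * (w W).2.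
    by rewrite uE// hE// -affE !dotE !mxE; ring.
  rewrite uhE uE// pE// !affE -/U -/P -/(w U) -/(w P) /h0 /h1 /h2 /A /B /K.
  by field; rewrite gt_eqF.
rewrite dist /int1 /int2 /int3 /h0 /h1 /h2 /A /B.
by field; rewrite gt_eqF.
Qed.

End CutElement.

(** * Summation over the triangles of the mesh *)

Unset Implicit Arguments.
Set Strict Implicit.

Theorem proposition5p3 (R : realType) (T : mesh R)
  (hat : 'I_(nnodes T) -> 'cV[R]_2 -> R) (hhat : is_hat_basis hat)
  (* problem data *)
  (lam1 lam2 al1 al2 alt1 alt2 f1 f2 c1 c2 : R)
  (hlam1 : 0 < lam1) (hlam2 : 0 < lam2)
  (hal1 : 0 <= al1) (hal2 : 0 <= al2)
  (halt1 : 0 <= alt1) (halt2 : 0 <= alt2)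
  (GammaD GammaN : set 'cV[R]_2)
  (hGamma : GammaD `|` GammaN = boundary (dom T))
  (hGammaI : GammaD `&` GammaN = set0)
  (hwell : (0 < boundary_length T GammaD)%E \/ (0 < al1 /\ 0 < al2))
  (gD : 'cV[R]_2 -> R)
  (uhat : 'cV[R]_2 -> R) (huhat : Sh1 T uhat)
  (hc1 : c1 = 0)
  (* level set function and perturbed node *)
  (phi : 'cV[R]_2 -> R) (hphi : Sh1 T phi)
  (hlevel : is_level_set_function T phi)
  (k : 'I_(nnodes T)) (hk : frakS phi k)
  (* cut configurations *)
  (cfg : 'I_(ntri T) -> config)
  (hcfg : forall l, l \in C_ hat phi k -> has_config hat phi k l (cfg l))
  (hcfgC : forall l I, I_ k l -> has_config hat phi k l I ->
     l \in C_ hat phi k)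
  (* discrete state and adjoint *)
  (u p : 'cV[R]_2 -> R)
  (hu : is_discrete_state T (Omega T phi) GammaD gD
          lam1 lam2 al1 al2 f1 f2 u)
  (hp : is_discrete_adjoint T (Omega T phi) GammaD
          lam1 lam2 al1 al2 alt1 alt2 c2 u uhat p)
  (n : 'cV[R]_2 -> 'cV[R]_2) (hn : is_outer_normal T phi n)
  (V : 'cV[R]_2 -> 'cV[R]_2) (hV : is_Vk hat phi k cfg V) :
  let dlam := lam1 - lam2 in
  let dal := al1 - al2 in
  let df := f1 - f2 in
  let dalt := alt1 - alt2 in
  let ul := nodal k ^~ u in
  let pl := nodal k ^~ p in
  let uhatl := nodal k ^~ uhat in
  dg T phi (Lh c1 c2 dlam dal dalt df u p uhat n) n V =
    dlam * (\sum_(l in C_ hat phi k)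
              bil3 (pl l) (k0 (J k l)) (ul l) * dka phi k (cfg l) l)
  + dal * (\sum_(l in C_ hat phi k)
              bil3 (pl l) (dkm phi k (cfg l) l) (ul l))
  - df * (\sum_(l in C_ hat phi k) dot3 (pl l) (dkf phi k (cfg l) l))
  + c2 * dalt * (\sum_(l in C_ hat phi k)
              bil3 (ul l - uhatl l) (dkm phi k (cfg l) l) (ul l - uhatl l))
  - 2 * dlam * (\sum_(l in C_ hat phi k)
              on_interface phi l (fun y => dot (grad u y) (n y))
              * on_interface phi l (fun y => dot (grad p y) (n y))
              * dka phi k (cfg l) l).

Proof.
move=> dlam dal df dalt ul pl uhatl; rewrite hc1.
have [Su _ _] := hu; have [Sp _ _] := hp; have [hV1 hV0] := hV.
have inCP l : l \in C_ hat phi k -> I_ k l by rewrite inE => /asboolP[].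
rewrite /dg (bigID (fun l => l \in C_ hat phi k))/= [X in _ + X]big1 ?addr0.
  rewrite !mulr_sumr -!(sumrN, big_split)/=; apply: eq_bigr => l lC.
  apply: (cut_element _ _ _ _ _ hhat) => //; [exact: inCP|exact: hcfg|].
  by move=> s; exact: hV1.
(* Outside [C_] the integrand is zero: open triangles are disjoint, so such an interface point lies
   in no triangle of [C_], and there [V] vanishes. *)
move=> l lNC; apply: segment_integral0 => y iy.
rewrite hV0.
- by rewrite dotE !mxE !mul0r addr0 mulr0.
- by case: iy => /tri_sub_dom.
- by case: iy.
- move=> l' l'C il'; move: lNC.
  by rewrite (interface_disjoint iy il') l'C.
Qed.
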